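(* Let $n\ge 1$ and $m\ge 0$ be integers. Then $$\sum_{A} \operatorname{sgn}(A) \;=\; 3^{\binom{n+1}{2}} \prod_{i=1}^n \frac{(2n+m+2-3i)_i}{(i)_i},$$ where the sum is over all arrowed Gelfand–Tsetlin patterns $A$ with $n$ rows in which no entry is decorated with the double arrow $\nwarrow\nearrow$, whose entries are all integers in $\{0,1,\ldots,m\}$, and whose bottom row is strictly increasing.
   Context: A Gelfand–Tsetlin pattern with $n$ rows is a triangular array of integers $(a_{i,j})_{1\le j\le i\le n}$, row $i$ being $a_{i,1},\ldots,a_{i,i}$, drawn so that $a_{i-1,j}$ sits between $a_{i,j}$ and $a_{i,j+1}$, satisfying $a_{i+1,j}\le a_{i,j}\le a_{i+1,j+1}$ for all $1\le j\le i<n$. Row $n$ is the bottom row. For an entry $a_{i,j}$: its $\nwarrow$-neighbor is $a_{i-1,j-1}$ and its $\nearrow$-neighbor is $a_{i-1,j}$ (when they exist), its $\swarrow$-neighbor is $a_{i+1,j}$ and its $\searrow$-neighbor is $a_{i+1,j+1}$, and its left/right neighbors are $a_{i,j-1}$, $a_{i,j+1}$. An arrowed Gelfand–Tsetlin pattern is a Gelfand–Tsetlin pattern in which each entry either carries no decoration or carries exactly one decoration from $\{\nwarrow,\nearrow,\nwarrow\nearrow\}$ (the last one is called the double arrow), subject to: if an entry $a$ equals its $\nearrow$-neighbor and is decorated with $\nearrow$ or $\nwarrow\nearrow$, then the entry to the right of $a$ in the same row also equals $a$ and is decorated with $\nwarrow$ or $\nwarrow\nearrow$; and if $a$ equals its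 $\nwarrow$-neighbor and is decorated with $\nwarrow$ or $\nwarrow\nearrow$, then the entry to the left of $a$ in the same row also equals $a$ and is decorated with $\nearrow$ or $\nwarrow\nearrow$. A special little triangle is an entry $a$ that equals both its $\swarrow$-neighbor $b$ and its $\searrow$-neighbor $c$, where $b$ is decorated with $\nearrow$ or $\nwarrow\nearrow$ and $c$ is decorated with $\nwarrow$ or $\nwarrow\nearrow$. The sign is $\operatorname{sgn}(A)=(-1)^{\#\text{special little triangles in }A}$. Pochhammer symbol: $(a)_k=a(a+1)\cdots(a+k-1)$, $(a)_0=1$. *)

(* Defs.v *)
From mathcomp Require Import all_boot all_order all_algebra.
Set Implicit Arguments. Unset Strict Implicit. Unset Printing Implicit Defensive.
Import Order.TTheory GRing.Theory Num.Theory.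

(* Conventions (0-based indices): row i (0 <= i < n) has entries j with 0 <= j <= i.
   Row n-1 is the bottom row. Entry (i,j) has NW-neighbour (i-1,j-1), NE-neighbour (i-1,j),
   SW-neighbour (i+1,j), SE-neighbour (i+1,j+1). *)

(* Decorations encoded in 'I_4: 0 = none, 1 = NW, 2 = NE, 3 = double arrow NW NE. *)
Definition dec_nw (d : nat) : bool := (d == 1) || (d == 3).
Definition dec_ne (d : nat) : bool := (d == 2) || (d == 3).

(* A decorated triangular array: entries in {0..m} and decorations, indexed by 'I_n * 'I_n;
   positions with j > i lie outside the triangle and are required to be trivial. *)
Definition Pat (n m : nat) := ({ffun 'I_n * 'I_n -> 'I_m.+1} * {ffun 'I_n * 'I_n -> 'I_4})%type.

Section PatDefs.
Variables (n m : nat).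
Implicit Type P : Pat n m.

Definition ent P (i j : nat) : nat :=
  match (insub i : option 'I_n), (insub j : option 'I_n) with
  | Some i', Some j' => val (P.1 (i', j'))
  | _, _ => 0
  end.

Definition dec P (i j : nat) : nat :=
  match (insub i : option 'I_n), (insub j : option 'I_n) with
  | Some i', Some j' => val (P.2 (i', j'))
  | _, _ => 0
  end.

Definition triangular P : bool :=
  [forall i : 'I_n, forall j : 'I_n,
     (i < j) ==> (P.1 (i, j) == ord0) && (P.2 (i, j) == ord0)].

Definition is_GT P : bool :=
  [forall i : 'I_n, forall j : 'I_n,
     (j <= i) && (i.+1 < n) ==>
       (ent P i.+1 j <= ent P i j) && (ent P i j <= ent P i.+1 j.+1)].

Definition arrows_ok P : bool :=
  [forall i : 'I_n, forall j : 'I_n, (j <= i) ==>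
    [&& ((0 < i) && (j < i) && (ent P i j == ent P i.-1 j) && dec_ne (dec P i j)) ==>
          ((ent P i j.+1 == ent P i j) && dec_nw (dec P i j.+1))
      & ((0 < i) && (0 < j) && (ent P i j == ent P i.-1 j.-1) && dec_nw (dec P i j)) ==>
          ((ent P i j.-1 == ent P i j) && dec_ne (dec P i j.-1))]].

Definition arrowed_GT P : bool := [&& triangular P, is_GT P & arrows_ok P].

Definition no_double P : bool :=
  [forall i : 'I_n, forall j : 'I_n, dec P i j != 3].

Definition bottom_strict P : bool :=
  [forall j : 'I_n, (j.+1 < n) ==> (ent P n.-1 j < ent P n.-1 j.+1)].

Definition nspecial P : nat :=
  \sum_(i < n) \sum_(j < n)
    [&& j <= i, i.+1 < n, ent P i j == ent P i.+1 j, ent P i j == ent P i.+1 j.+1,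
        dec_ne (dec P i.+1 j) & dec_nw (dec P i.+1 j.+1)].

Definition sgn P : int := (-1) ^+ nspecial P.

End PatDefs.

Definition poch (a : rat) (k : nat) : rat := \prod_(l < k) (a + l%:R).

(* Main.v *)
(* Let the i-th row carry a variable x_i.  Special little triangles turn the
   interlacing conditions into extended geometric sums, so that the generating
   function of the patterns with bottom row k, times the Vandermonde product of x,
   is prod_i (1 + x_i + 1/x_i) times the antisymmetrization of
   prod_(p < q) (1 + x_q + x_p x_q) prod_i x_i^k_i.  Summing over all strictly
   increasing k with entries at most m yields, up to the factor
   prod_i (1 - x_i) prod_(p < q) (1 - x_p x_q), the determinant of
   z_i^j - x_i^A w_i^j with z = x + x^2, w = 1/x + 1/x^2 and A = m + 2n - 1; this is
   proved by induction on m, adding the terms whose last entry is m.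
   With x = (1 + e)/(1 - e) the entries are odd in e up to a factor, so letting
   x tend to 1 leaves a determinant of coefficients that is polynomial in A.  It is
   determined by its degree, its leading coefficient and its zeros: as
   1 + w = (1 + z)/x^2 and w = z/x^3, replacing z^a by z^b (1 + z)^(a - b) in column
   a produces the factor A - 2a - b. *)
Require Import Defs.
From mathcomp Require Import all_boot all_order all_algebra all_fingroup.
From mathcomp Require Import ring zify.
From Stdlib Require Import FunctionalExtensionality.
Set Implicit Arguments. Unset Strict Implicit. Unset Printing Implicit Defensive.
Import Order.TTheory GRing.Theory Num.Theory.
Local Open Scope ring_scope.

(** * Signed sums over permutations *)

(** Setting all variables to 1 in the operator formula gives 0 = 0, because of the Vandermonde
    product; the variables must stay distinct until a limit can be taken. In e, the Vandermonde
    product and the products of 1 - x_i and 1 - x_p x_q vanish together to order n + 2 binom(n, 2).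
    The determinant matches this order exactly: its entries are e times even functions of e, so it
    yields e^n and then binom(n, 2) powers of e^2. The degree count in A is the delicate point. Row
    k has degree 2k + 1, so the obvious bound is n^2, while there are only binom(n + 1, 2) zeros to
    use. Powers of u - 2, which vanishes at w = 0, save a degree a in column a and bring the bound
    down to that number. Zeros also occur with multiplicity, and each value of A needs a basis of
    its own, so the powers of distinct linear factors are treated separately. The power of 3 has two
    sources: 1 + x + 1/x at x = 1 gives 3^n, and the expansion -2w(3 + w) behind u - 2 gives the
    rest. *)

Section SignedSums.
Variables (R : comNzRingType) (n : nat).

(** Laplace expansion for a summand that need not be a product over rows: the factor [pf (x \o s)]
    used below couples all values of [s], so determinant expansions do not apply to it. *)
Lemma sum_sign_lift_perm (i j : 'I_n.+1) (F : 'S_n.+1 -> R) :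
  \sum_(s : 'S_n.+1 | s i == j) (-1) ^+ s * F s =
  (-1) ^+ (i + j) * \sum_(t : 'S_n) (-1) ^+ t * F (lift_perm i j t).
Proof.
rewrite (reindex (lift_perm i j)); last first.
  (* [ulsf] deletes row [i] and its image from the permutation, which inverts [lift_perm]. *)
  pose ulsf i (s : 'S_n.+1) k := odflt k (unlift (s i) (s (lift i k))).
  have ulsfK k0 (s : 'S_n.+1) k: lift (s k0) (ulsf k0 s k) = s (lift k0 k).
    rewrite /ulsf; have:= neq_lift k0 k.
    by rewrite -(can_eq (permK s)) => /unlift_some[] ? ? ->.
  have inj_ulsf: injective (ulsf i _).
    move=> s; apply: can_inj (ulsf (s i) s^-1%g) _ => k'.
    by rewrite {1}/ulsf ulsfK !permK liftK.
  exists (fun s => perm (inj_ulsf s)) => [s _ | s].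
    by apply/permP=> k'; rewrite permE /ulsf lift_perm_lift lift_perm_id liftK.
  move/(s _ =P _) => si0; apply/permP=> k.
  case: (unliftP i k) => [k'|] ->; rewrite ?lift_perm_id //.
  by rewrite lift_perm_lift -si0 permE ulsfK.
rewrite big_distrr /=; apply: eq_big => [s | s _]; first by rewrite lift_perm_id eqxx.
by rewrite odd_lift_perm mulrA !signr_addb -(signr_odd _ (i + j)) oddD signr_addb.
Qed.

Lemma sum_sign_expand_row (i : 'I_n.+1) (F : 'S_n.+1 -> R) :
  \sum_(s : 'S_n.+1) (-1) ^+ s * F s =
  \sum_(j < n.+1) (-1) ^+ (i + j) * \sum_(t : 'S_n) (-1) ^+ t * F (lift_perm i j t).
Proof.
rewrite (partition_big (fun s : 'S_n.+1 => s i) predT) //=.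
by apply: eq_bigr => j _; rewrite -sum_sign_lift_perm.
Qed.

Lemma sum_sign_expand_col (j : 'I_n.+1) (F : 'S_n.+1 -> R) :
  \sum_(s : 'S_n.+1) (-1) ^+ s * F s =
  \sum_(i < n.+1) (-1) ^+ (i + j) * \sum_(t : 'S_n) (-1) ^+ t * F (lift_perm i j t).
Proof.
rewrite (partition_big (fun s : 'S_n.+1 => s^-1%g j) predT) //=.
apply: eq_bigr => i _; rewrite -sum_sign_lift_perm; apply: eq_bigl => s.
by rewrite -(inj_eq (@perm_inj _ s)) permKV eq_sym.
Qed.

End SignedSums.

Lemma sum_sign_tperm_eq0 (R : numDomainType) n (i j : 'I_n) (F : 'S_n -> R) :
  i != j -> (forall s : 'S_n, F (tperm i j * s)%g = F s) ->
  \sum_(s : 'S_n) (-1) ^+ s * F s = 0.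
Proof.
move=> neij Finv; set S := \sum_s _.
suff: S = - S by move/eqP; rewrite -addr_eq0 -mulr2n mulrn_eq0 /= => /eqP.
rewrite {1}/S (reindex_inj (mulgI (tperm i j))) /= -sumrN; apply: eq_bigr => s _.
by rewrite Finv odd_mul_tperm neij signr_addb expr1 mulN1r mulNr.
Qed.

Section PairProducts.
Variable (R : comNzRingType).

Definition pairprod n (f : 'I_n -> 'I_n -> R) : R :=
  \prod_(p < n) \prod_(q < n | (p < q)%N) f p q.

Lemma pairprod_lift n (i : 'I_n.+1) (f : 'I_n.+1 -> 'I_n.+1 -> R) :
  pairprod f = pairprod (fun p q => f (lift i p) (lift i q)) *
    \prod_(p < n) (if (lift i p < i)%N then f (lift i p) i else f i (lift i p)).
Proof.
have E m (g : 'I_m -> 'I_m -> R) :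
    pairprod g = \prod_(p < m) \prod_(q < m) (if (p < q)%N then g p q else 1).
  by apply: eq_bigr => p _; rewrite big_mkcond.
rewrite !E (bigD1_ord i) //= (bigD1_ord i) //= ltnn mul1r.
under [X in _ * X]eq_bigr => p _ do rewrite (bigD1_ord i) //=.
rewrite big_split /= mulrA mulrC -big_split /=; congr (_ * _).
  apply: eq_bigr => p _; apply: eq_bigr => q _.
  by congr (if _ then _ else _); rewrite /= /bump; lia.
apply: eq_bigr => p _; have := neq_lift i p; rewrite -val_eqE.
by case: ltngtP => //; rewrite ?mul1r ?mulr1.
Qed.

(** Exchanging adjacent indices reverses the order of no pair other than (i, j). The identity is
    cross-multiplied because [f i j] may vanish. *)
Lemma pairprod_swap n (i j : 'I_n) (f : 'I_n -> 'I_n -> R) : j = i.+1 :> nat ->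
  pairprod (fun p q => f (tperm i j p) (tperm i j q)) * f i j = pairprod f * f j i.
Proof.
move=> ij; have E g : pairprod g = \prod_(u : 'I_n * 'I_n | (u.1 < u.2)%N) g u.1 u.2.
  by rewrite /pairprod pair_big_dep.
have lij : (i < j)%N by rewrite ij.
rewrite !E (bigD1 (i, j)) //= [in RHS](bigD1 (i, j)) //= tpermL tpermR.
rewrite [RHS]mulrC [LHS]mulrC mulrCA; congr (_ * (_ * _)).
have tK : involutive (fun u : 'I_n * 'I_n => (tperm i j u.1, tperm i j u.2)).
  by case=> p q /=; rewrite !tpermK.
rewrite [RHS](reindex_inj (inv_inj tK)) /=; apply: eq_bigl => -[p q] /=.
rewrite !xpair_eqE; do 2!case: tpermP => [->|->|/eqP ? /eqP ?]; rewrite -?val_eqE /=; lia.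
Qed.

Lemma pairprod_nat n (f : nat -> nat -> R) :
  pairprod (fun p q : 'I_n => f p q) = \prod_(q < n) \prod_(p < q) f p q.
Proof.
elim: n => [|n IHn]; first by rewrite /pairprod !big_ord0.
rewrite big_ord_recr -IHn (pairprod_lift ord_max); congr (_ * _).
  by rewrite /pairprod; do 2![apply: eq_bigr => ? _]; rewrite !lift_max.
by apply: eq_bigr => p _; rewrite lift_max ltn_ord.
Qed.

End PairProducts.

Lemma big_ord_interval (T : Type) (idx : T) (op : Monoid.law idx) m lo hi (F : nat -> T) :
  (lo <= hi)%N -> (hi <= m)%N ->
  \big[op/idx]_(v < m | (lo <= v < hi)%N) F v = \big[op/idx]_(lo <= v < hi) F v.
Proof.
move=> lohi him; rewrite -(big_mkord (fun v => lo <= v < hi)%N F).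
rewrite (big_cat_nat (n := lo)) //=; last by lia.
rewrite (big_cat_nat (n := hi) (m := lo)) //=.
rewrite big_nat_cond big_pred0 ?Monoid.mul1m; last by move=> v; lia.
rewrite [X in op _ X]big_nat_cond [X in op _ X]big_pred0 ?Monoid.mulm1; last by move=> v; lia.
by rewrite big_nat_cond [RHS]big_nat_cond; apply: eq_bigl => v; lia.
Qed.

(** * The operator formula for a given bottom row *)

Section ChoiceTerms.
Variable K : numFieldType.

Definition pairfac (a b : K) : K := 1 + b + a * b.

Definition pf n (x : 'I_n -> K) : K := pairprod (fun p q => pairfac (x p) (x q)).

Definition Wsum n (k : 'I_n -> nat) (x : 'I_n -> K) : K :=
  \sum_(s : 'S_n) (-1) ^+ s * (pf (x \o s) * \prod_(i < n) x (s i) ^+ k i).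

(** Extending a row to all naturals lets the neighbouring positions [j.-1] and [j.+1] be written
    without bound proofs. *)
Definition natfun (T : Type) (d : T) n (f : 'I_n -> T) (j : nat) : T :=
  if insub j is Some i then f i else d.

Lemma natfunE (T : Type) (d : T) n (f : 'I_n -> T) (i : 'I_n) : natfun d f i = f i.
Proof. by rewrite /natfun valK. Qed.

(* The weight of a decoration in the encoding of [dec]; the double arrow is
   excluded by giving it weight 0. *)
Definition wt (z : K) (d : nat) : K :=
  if d == 0 then 1 else if d == 1 then z^-1 else if d == 2 then z else 0.

(* Sum over the decorations of one entry [k]: [xu] (resp. [xl]) is present when
   the entry to the upper left (resp. upper right) contributes the upper (resp.
   lower) endpoint of its geometric sum. *)
Definition csum (z : K) (k : nat) (ub lb : bool) (xu xl : K) : K :=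
  \sum_(d < 4) wt z d * z ^+ k *
    ((if ub then (xu / z) ^+ (k.+1 - dec_nw d) else 1) *
     (if lb then (xl / z) ^+ (k + dec_ne d) else 1)).

Lemma csumFF (z : K) k xu xl : csum z k false false xu xl = z ^+ k * (1 + z + z^-1).
Proof. rewrite /csum !big_ord_recl big_ord0 /wt /=; ring. Qed.

Lemma csumFT (z : K) k (xu xl : K) : z != 0 ->
  csum z k false true xu xl = xl ^+ k * pairfac xl z / z.
Proof.
move=> z0; rewrite /csum !big_ord_recl big_ord0 /wt /pairfac /dec_ne /= !addn0 ?addn1 !exprS !expr_div_n.
by field; rewrite ?expf_neq0 ?z0 ?x0.
Qed.

Lemma csumTF (z : K) k (xu xl : K) : z != 0 -> xu != 0 ->
  csum z k true false xu xl = xu ^+ k * pairfac z xu / z.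
Proof.
move=> z0 x0; rewrite /csum !big_ord_recl big_ord0 /wt /pairfac /dec_nw /= !subn0 ?subn1 /= !exprS !expr_div_n.
by field; rewrite ?expf_neq0 ?z0 ?x0.
Qed.

(** The order of the arguments is what matters: [pairfac xl xu] is the reverse of the factor
    [pairfac xu xl] contained in [pf], so their product is symmetric. *)
Lemma csumTT (z : K) k (xu xl : K) : z != 0 -> xu != 0 ->
  csum z k true true xu xl = (xu * xl / z) ^+ k * pairfac xl xu / z.
Proof.
move=> z0 x0; rewrite /csum !big_ord_recl big_ord0 /wt /pairfac /dec_nw /dec_ne /=.
rewrite !subn0 ?subn1 !addn0 ?addn1 /= !exprS !expr_div_n exprMn.
by field; rewrite ?expf_neq0 ?z0 ?x0.
Qed.

(** One term of the expanded product of geometric sums. Entry [j] of the upper row contributes its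
    upper endpoint, which involves entry [j.+1] below, if [b j] holds, and otherwise its lower
    endpoint, which involves entry [j] below. The factors are grouped by entries of the lower
    row. *)
Definition choiceterm (z : K) r (k : nat -> nat) (b : nat -> bool) (y : nat -> K) : K :=
  \prod_(j < r.+1) csum z (k j) ((0 < j)%N && b j.-1) ((j < r)%N && ~~ b j) (y j.-1) (y j).

(* An entry used as upper endpoint by its left neighbour above and as lower
   endpoint by the right one gives a factor symmetric in the two variables. *)
Lemma choiceterm_swap (z : K) r k (b : nat -> bool) (i j : 'I_r) (x : 'I_r -> K) :
  z != 0 -> (forall p, x p != 0) ->
  j = i.+1 :> nat -> b i -> ~~ b j ->
  pf (x \o tperm i j) * choiceterm z r k b (natfun 0 (x \o tperm i j)) =
  pf x * choiceterm z r k b (natfun 0 x).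
Proof.
move=> z0 x0 ij bi bj.
have jr : (j < r.+1)%N by apply: leq_trans (ltn_ord j) _.
rewrite /choiceterm (bigD1 (Ordinal jr)) //= [in RHS](bigD1 (Ordinal jr)) //= !natfunE.
have -> : j.-1 = i by rewrite ij.
have j0 : (0 < j)%N by rewrite ij.
rewrite ltn_ord bi bj j0 /= !natfunE /= tpermL tpermR !csumTT //.
have := pairprod_swap (fun p q => pairfac (x p) (x q)) ij.
rewrite -/(pf x) -/(pf (x \o tperm i j)) => pfE.
set Q1 := \prod_(_ < _ | _) _; set Q2 := \prod_(_ < _ | _) _.
have -> : Q1 = Q2.
  apply: eq_bigr => l; rewrite -val_eqE /= => lj.
  have inv (p : nat) : p != i -> p != j -> natfun 0 (x \o tperm i j) p = natfun 0 x p.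
    move=> pi pj; rewrite /natfun; case: insubP => // p' _ pp' /=.
    by rewrite tpermD // -val_eqE /= pp' eq_sym.
  rewrite (_ : csum _ _ _ _ _ _ = csum z (k l) ((0 < l)%N && b l.-1) ((l < r)%N && ~~ b l)
     (natfun 0 x l.-1) (natfun 0 (x \o tperm i j) l)); last first.
    have [l1|l1] := eqVneq l.-1 (i : nat).
      have l0 : l = 0%N :> nat by lia.
      by rewrite l0 /csum.
    have [l2|l2] := eqVneq l.-1 (j : nat).
      by rewrite l2 (negPf bj) andbF /csum.
    by rewrite [natfun _ (_ \o _) l.-1]inv.
  have [l1|l1] := eqVneq (l : nat) (i : nat).
    by rewrite l1 bi andbF /csum.
  by rewrite [natfun _ (_ \o _) l]inv.
rewrite [x j * x i]mulrC; move: pfE; rewrite /= -[X in X = _ -> _]/(pf (x \o tperm i j) * _) => pfE.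
transitivity ((x i * x j / z) ^+ k j / z * Q2 * (pf (x \o tperm i j) * pairfac (x i) (x j))).
  by ring.
by rewrite pfE; ring.
Qed.

End ChoiceTerms.

Definition descent r (b : {ffun 'I_r -> bool}) : bool :=
  [exists i : 'I_r, exists j : 'I_r, [&& j == i.+1 :> nat, b i & ~~ b j]].

Definition threshold r (s : 'I_r.+1) : {ffun 'I_r -> bool} := [ffun j : 'I_r => (s <= j)%N].

(** A choice that never passes from true to false is false before some [s] and true from [s] on. *)
Lemma sum_threshold (V : nmodType) r (F : {ffun 'I_r -> bool} -> V) :
  \sum_b F b = \sum_(s < r.+1) F (threshold s) + \sum_(b | descent b) F b.
Proof.
rewrite (bigID (fun b => descent b)) /= addrC; congr (_ + _).
have inj : {in predT &, injective (@threshold r)}.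
  have lt_neq (s t : 'I_r.+1) : (s < t)%N -> threshold s <> threshold t.
    move=> st /ffunP; have sr : (s < r)%N by have := ltn_ord t; lia.
    by move/(_ (Ordinal sr)); rewrite !ffunE /= leqnn leqNgt st.
  move=> s t _ _ E; apply/val_inj/eqP; case: ltngtP => // lt; first by case: (lt_neq s t).
  by case: (lt_neq t s).
rewrite -(big_imset _ inj) /=; apply: eq_bigl => b.
apply/negP/imsetP => [nd | [s _ ->]]; last first.
  case/existsP=> i /existsP [j]; rewrite !ffunE => /and3P [/eqP ->]; lia.
(* Counting [r] as a true position guarantees a minimum and makes [s = r] the constantly false
   choice. *)
pose P j := (j == r) || natfun false b j.
have exP : exists j, P j by exists r; rewrite /P eqxx.
case: (ex_minnP exP) => s Ps smin.
have sr : (s < r.+1)%N by rewrite ltnS; apply: smin; rewrite /P eqxx.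
exists (Ordinal sr) => //; apply/ffunP => j; rewrite ffunE /=.
case: leqP => sj; last first.
  apply: contraTF sj => bj; rewrite -leqNgt; apply: smin.
  by rewrite /P natfunE bj orbT.
have up m : (s + m < r)%N -> natfun false b (s + m).
  elim: m => [|m IHm] lr.
    move: Ps lr; rewrite addn0 /P => /orP [/eqP ->|//]; by rewrite ltnn.
  have lr' : (s + m < r)%N by lia.
  apply: contraT => nb; case: nd; apply/existsP; exists (Ordinal lr').
  apply/existsP; exists (Ordinal lr).
  apply/and3P; split; first by rewrite /= addnS.
    by rewrite -(natfunE false b) IHm.
  by rewrite -(natfunE false b).
by rewrite -(natfunE false b) -(subnKC sj) up // subnKC.
Qed.

Section Branching.
Variable K : numFieldType.

(** Entries left of [s] receive only a lower endpoint and entries right of [s] only an upper one.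
    Entry [s] receives neither, so it keeps the variable [z] and the full decoration sum. *)
Lemma choiceterm_threshold (z : K) r k (s : 'I_r.+1) (x : 'I_r -> K) :
  z != 0 -> (forall p, x p != 0) ->
  choiceterm z r k (natfun false (threshold s)) (natfun 0 x) =
  (1 + z + z^-1) * z ^- r * (z ^+ k s * \prod_(p < r) x p ^+ k (lift s p)) *
    \prod_(p < r) (if (lift s p < s)%N then pairfac (x p) z else pairfac z (x p)).
Proof.
move=> z0 x0; rewrite /choiceterm (bigD1_ord s) //=.
have thr j : natfun false (threshold s) j = (s <= j)%N && (j < r)%N.
  rewrite /natfun; case: insubP => [u ur uj|]; first by rewrite ffunE /= uj ur andbT.
  by move/negPf ->; rewrite andbF.
have -> : (0 < s)%N && natfun false (threshold s) s.-1 = false by rewrite thr; lia.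
have -> : (s < r)%N && ~~ natfun false (threshold s) s = false by rewrite thr; lia.
rewrite csumFF (eq_bigr (fun p => z^-1 * (x p ^+ k (lift s p) *
    (if (lift s p < s)%N then pairfac (x p) z else pairfac z (x p))))); last first.
  move=> p _.
  rewrite !thr /=; have pr := ltn_ord p; case: (ltnP (bump s p) s) => lift_s.
    have lp : (bump s p = p) by move: lift_s; rewrite /bump; lia.
    rewrite lp in lift_s *.
    have -> : (0 < p)%N && ((s <= p.-1)%N && (p.-1 < r)%N) = false by lia.
    by rewrite pr /= csumFT // natfunE; ring.
  have lp : (bump s p = p.+1) by move: lift_s; rewrite /bump; lia.
  rewrite lp /= in lift_s *.
  have sp : (s <= p)%N by move: lp; rewrite /bump; lia.
  rewrite sp pr /=.
  by rewrite andbN natfunE csumTF //; ring.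
rewrite big_split /= prodr_const card_ord exprVn big_split /=; ring.
Qed.

(** Choices with a descent cancel under the transposition of the two variables involved. The
    threshold [s] matches the permutations that put the new variable [z] in position [s]: its sign
    (-1)^s from the lower endpoints differs from the cofactor sign by (-1)^r. *)
Lemma branching r (k : nat -> nat) (X : 'I_r.+1 -> K) : (forall p, X p != 0) ->
  let z := X ord_max in let x := X \o lift ord_max in
  \sum_(s : 'S_r) (-1) ^+ s * (pf (x \o s) *
     \sum_(b : {ffun 'I_r -> bool}) (\prod_j (if b j then 1 else -1)) *
        choiceterm z r k (natfun false b) (natfun 0 (x \o s))) =
  (-1) ^+ r * (1 + z + z^-1) * z ^- r * Wsum (fun i : 'I_r.+1 => k i) X.
Proof.
move=> X0 z x; have z0 : z != 0 by apply: X0.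
have x0 p : x p != 0 by apply: X0.
pose T (b : {ffun 'I_r -> bool}) (s : 'S_r) : K :=
  pf (x \o s) * choiceterm z r k (natfun false b) (natfun 0 (x \o s)).
pose sg (b : {ffun 'I_r -> bool}) : K := \prod_j (if b j then 1 else -1).
transitivity (\sum_(b : {ffun 'I_r -> bool}) sg b * \sum_(s : 'S_r) (-1) ^+ s * T b s).
  under eq_bigr do rewrite !mulr_sumr.
  rewrite exchange_big; apply: eq_bigr => b _; rewrite mulr_sumr; apply: eq_bigr => s _.
  by rewrite /T -/(sg b) [pf _ * (_ * _)]mulrCA [LHS]mulrCA.
rewrite (sum_threshold (fun b => sg b * \sum_(s : 'S_r) (-1) ^+ s * T b s)).
rewrite [X in _ + X]big1 ?addr0; last first.
  move=> b /existsP [i /existsP [j /and3P [/eqP ij bi bj]]].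
  rewrite (sum_sign_tperm_eq0 (i := i) (j := j)) ?mulr0 //; first by rewrite -val_eqE /= ij; lia.
  move=> s; rewrite /T.
  have -> : x \o (tperm i j * s)%g = (x \o s) \o tperm i j.
    by apply: functional_extensionality => p; rewrite /= permM.
  by apply: choiceterm_swap; rewrite ?natfunE // => p; apply: x0.
rewrite /Wsum (sum_sign_expand_col ord_max) mulr_sumr; apply: eq_bigr => s _.
rewrite !mulr_sumr; apply: eq_bigr => t _.
have -> : sg (threshold s) = (-1) ^+ s.
  rewrite /sg; under eq_bigr do rewrite ffunE.
  rewrite (eq_bigr (fun j : 'I_r => if (j < s)%N then (-1 : K) else 1)); last by move=> j _; case: leqP.
  have sr : (s <= r)%N by rewrite -ltnS.
  by rewrite -big_mkcond /= (big_ord_narrow sr) prodr_const card_ord.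
rewrite /T choiceterm_threshold //; last by move=> p; apply: x0.
have -> : pf (X \o lift_perm s ord_max t) = pf (x \o t) *
    \prod_(p < r) (if (lift s p < s)%N then pairfac (x (t p)) z else pairfac z (x (t p))).
  rewrite /pf (pairprod_lift s) /=; congr (_ * _).
    by rewrite /pairprod; do 2![apply: eq_bigr => ? _]; rewrite !lift_perm_lift.
  by apply: eq_bigr => p _; rewrite lift_perm_id lift_perm_lift.
rewrite (bigD1_ord s) //= lift_perm_id.
under [X in _ = _ * (_ * (_ * (_ * (_ * X))))]eq_bigr do rewrite lift_perm_lift.
rewrite exprD; have := signrMK r (1 : K); rewrite mulr1 => sgE.
set P1 := \prod_(p < r) _; set P2 := \prod_(p < r) _.
set e := (-1) ^+ r in sgE *; set e' := (-1) ^+ s; set e'' := (-1) ^+ t.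
rewrite /= -/z.
transitivity ((e * e) * (e' * (e'' * (pf (x \o t) * ((1 + z + z^-1) * z ^- r * (z ^+ k s * P1) * P2))))); last by ring.
by rewrite sgE mul1r.
Qed.

End Branching.

(** Rows of all lengths [r] live in the same finite function type; fixing the positions from [r] on
    makes the representation unique. *)
Definition padded (T : eqType) (t0 : T) N (r : nat) (f : 'I_N -> T) : bool :=
  [forall j : 'I_N, (r <= j)%N ==> (f j == t0)].

Lemma natr_forall (R : comNzSemiRingType) (I : finType) (P : pred I) :
  [forall i, P i]%:R = \prod_i (P i)%:R :> R.
Proof.
have [/forallP allP | /forallPn [i nPi]] := boolP [forall i, P i].
  by rewrite big1 // => i _; rewrite allP.
by rewrite (bigD1 i) //= (negPf nPi) mul0r.
Qed.

Lemma sum_padded (R : comNzSemiRingType) (T : finType) (t0 : T) N r (g : nat -> T -> R) :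
  (r <= N)%N ->
  \sum_(f : {ffun 'I_N -> T}) (padded t0 r f)%:R * \prod_(j < r) g j (natfun t0 f j) =
  \prod_(j < r) \sum_t g j t.
Proof.
move=> rN; pose h (j : nat) t : R := if (j < r)%N then g j t else (t == t0)%:R.
transitivity (\sum_(f : {ffun 'I_N -> T}) \prod_(j < N) h j (f j)).
  apply: eq_bigr => f _; rewrite (big_ord_widen N (fun j => g j (natfun t0 f j)) rN).
  rewrite natr_forall [X in _ * X]big_mkcond -big_split /=; apply: eq_bigr => j _.
  by rewrite /h natfunE; case: ltnP; rewrite /= ?mul1r ?mulr1.
rewrite -(bigA_distr_bigA (fun (j : 'I_N) => h j)) (big_ord_widen N (fun j => \sum_t g j t) rN).
rewrite [RHS]big_mkcond /=; apply: eq_bigr => j _; rewrite /h; case: ltnP => // _.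
by rewrite (bigD1 t0) //= eqxx big1 ?addr0 // => t /negPf ->.
Qed.

(** The order and arrow rules localize to small triangles: [v] lies above [a] (southwest) and [b]
    (southeast), [ne] says that [a] points to [v], and [nw] says that [b] does. *)
Definition psiok (a b : nat) (ne nw : bool) (v : nat) : bool :=
  [&& (a <= v)%N, (v <= b)%N, (v == a) && ne ==> (b == a) && nw
    & (v == b) && nw ==> (a == b) && ne].

Definition psispecial (a b : nat) (ne nw : bool) (v : nat) : bool :=
  [&& v == a, v == b, ne & nw].

Section OperatorFormula.
Variable K : numFieldType.

Definition psi a b ne nw v : K :=
  (-1) ^+ psispecial a b ne nw v * (psiok a b ne nw v)%:R.

Lemma sum_expr_interval (m lo hi : nat) (y : K) : y != 1 -> (lo <= hi)%N -> (hi <= m)%N ->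
  \sum_(v < m | (lo <= v < hi)%N) y ^+ v = (y ^+ hi - y ^+ lo) / (y - 1).
Proof.
move=> y1 lohi him; rewrite (big_ord_interval _ (fun v => y ^+ v)) //.
rewrite -(telescope_sumr (fun v => y ^+ v)) // mulr_suml; apply: eq_bigr => v _.
have -> : y ^+ v.+1 - y ^+ v = y ^+ v * (y - 1) by rewrite exprS; ring.
by rewrite mulfK // subr_eq0.
Qed.

(* The rules for equal entries amount to the convention that a sum from [a + 1]
   to [a - 1] is minus the value at [a]; this is what [psi] encodes. *)
Lemma sum_psi (m a b : nat) ne nw (y : K) : y != 1 -> (a <= b)%N -> (b <= m)%N ->
  \sum_(v < m.+1) psi a b ne nw v * y ^+ v =
  (y ^+ (b.+1 - nw) - y ^+ (a + ne)) / (y - 1).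
Proof.
move=> y1 ab bm; have y10 : y - 1 != 0 by rewrite subr_eq0.
have [lt_ab | ge_ab] := ltnP a b.
  rewrite -(@sum_expr_interval m.+1) //; first last.
  - by case: nw; lia.
  - by case: ne; case: nw; lia.
  rewrite [RHS]big_mkcond /=; apply: eq_bigr => v _; rewrite /psi.
  have -> : psispecial a b ne nw v = false by rewrite /psispecial; case: ne; case: nw; lia.
  have -> : psiok a b ne nw v = (a + ne <= v < b.+1 - nw)%N.
    by rewrite /psiok; case: ne; case: nw; lia.
  by case: ifP => _; rewrite ?mul1r ?mulr0 ?mul0r.
have {ab ge_ab} E : a = b by lia.
subst a; have bm' : (b < m.+1)%N by lia.
rewrite (bigD1 (Ordinal bm')) //= big1 ?addr0 => [|v]; last first.
  rewrite -val_eqE /= => vb; have -> : psi b b ne nw v = 0; last by rewrite mul0r.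
  rewrite /psi; have -> : psiok b b ne nw v = false by rewrite /psiok; case: ne; case: nw; lia.
  by rewrite mulr0.
rewrite /psi /psiok /psispecial leqnn eqxx /=.
by case: ne; case: nw; rewrite /= ?subn0 ?subn1 ?addn0 ?addn1 /= ?exprS; field; rewrite ?y10.
Qed.

Variables (N m : nat).
Local Notation entries := {ffun 'I_N -> 'I_m.+1}.
Local Notation decs := {ffun 'I_N -> 'I_4}.

Definition rowwt (z : K) (r : nat) (l k : entries) (d : decs) : K :=
  (padded ord0 r.+1 k)%:R * (padded ord0 r.+1 d)%:R *
  \prod_(j < r.+1) (wt z (natfun ord0 d j) * z ^+ natfun ord0 k j) *
  \prod_(j < r) (psi (natfun ord0 k j) (natfun ord0 k j.+1) (dec_ne (natfun ord0 d j))
                     (dec_nw (natfun ord0 d j.+1)) (natfun ord0 l j)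
                 * z ^- natfun ord0 l j).

(* The signed weighted count of patterns with [r] rows and bottom row [k], the
   weight of row [i] being [x i] to the power: sum of row [i] minus sum of row
   [i - 1], plus the number of NE arrows, minus the number of NW arrows. *)
Fixpoint agtp (x : nat -> K) (r : nat) (k : entries) : K :=
  if r is r'.+1 then \sum_l \sum_d rowwt (x r') r' l k d * agtp x r' l
  else (padded ord0 0 k)%:R.

Lemma agtp_padded x r (k : entries) : ~~ padded ord0 r k -> agtp x r k = 0.
Proof.
case: r => [|r] /negPf npad; rewrite /= ?npad //.
rewrite big1 // => l _; rewrite big1 // => d _.
by rewrite /rowwt npad !mul0r.
Qed.

Definition incr (r : nat) (k : entries) : Prop :=
  forall j, (j.+1 < r)%N -> (natfun ord0 k j <= natfun ord0 k j.+1)%N.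

(** Consecutive upper entries are separated by their common lower neighbour. This provides the
    monotonicity that the induction in [operator_formula] requires of the row above. *)
Lemma rowwt_incr z r l k d : rowwt z r l k d != 0 -> incr r l.
Proof.
rewrite /rowwt !mulf_eq0 !negb_or => /andP [_ /prodf_neq0 psi0] j jr.
have ok i : (i < r)%N -> (natfun ord0 k i <= natfun ord0 l i <= natfun ord0 k i.+1)%N.
  move=> ir; have := psi0 (Ordinal ir) isT; rewrite mulf_eq0 negb_or /psi mulf_eq0 negb_or.
  case/andP=> /andP [_]; case E: (psiok _ _ _ _ _); rewrite ?eqxx // => _ _.
  by case/and4P: E => -> ->.
have /andP [_ h1] := ok j (ltnW jr); have /andP [h2 _] := ok _ jr.
exact: leq_trans h1 h2.
Qed.

(** Once the lower row and its decorations are fixed, the entries of the upper row are independent,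
    and each is summed by [sum_psi] with ratio [x j / z]. *)
Lemma sum_row_below (z : K) (r : nat) (k : entries) (d : decs) (x : 'I_r -> K) :
  (r <= N)%N -> z != 0 -> (forall p, x p != z) -> incr r.+1 k ->
  \sum_(l : entries) (padded ord0 r l)%:R *
    \prod_(j < r) (psi (natfun ord0 k j) (natfun ord0 k j.+1) (dec_ne (natfun ord0 d j))
                     (dec_nw (natfun ord0 d j.+1)) (natfun ord0 l j)
                 * z ^- natfun ord0 l j * x j ^+ natfun ord0 l j) =
  \prod_(j < r) (((x j / z) ^+ ((natfun ord0 k j.+1).+1 - dec_nw (natfun ord0 d j.+1)) -
     (x j / z) ^+ (natfun ord0 k j + dec_ne (natfun ord0 d j))) / (x j / z - 1)).
Proof.
move=> rN z0 xz inc.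
pose g j (v : 'I_m.+1) : K := psi (natfun ord0 k j) (natfun ord0 k j.+1)
  (dec_ne (natfun ord0 d j)) (dec_nw (natfun ord0 d j.+1)) v * z ^- v * natfun 0 x j ^+ v.
transitivity (\prod_(j < r) \sum_v g j v); last first.
  apply: eq_bigr => j _; rewrite -(@sum_psi m).
  - by apply: eq_bigr => v _; rewrite /g natfunE expr_div_n; ring.
  - by rewrite -(inj_eq (mulIf z0)) mul1r divfK.
  - by apply: inc; rewrite ltnS.
  - by rewrite /natfun; case: insub => // i; rewrite -ltnS.
rewrite -(sum_padded ord0 _ rN); apply: eq_bigr => l _; congr (_ * _).
by apply: eq_bigr => j _; rewrite /g natfunE.
Qed.

(** Neighbouring differences share a decoration, so the sum over [d] does not factor as it stands.
    After expanding every difference into its two endpoints, each decoration occurs in a single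
    factor. *)
Lemma sum_decorations (z : K) (r : nat) (k : nat -> nat) (x : 'I_r -> K) : (r < N)%N ->
  \sum_(d : decs) (padded ord0 r.+1 d)%:R *
    \prod_(j < r.+1) (wt z (natfun ord0 d j) * z ^+ k j) *
    \prod_(j < r) ((x j / z) ^+ ((k j.+1).+1 - dec_nw (natfun ord0 d j.+1)) -
       (x j / z) ^+ (k j + dec_ne (natfun ord0 d j))) =
  \sum_(b : {ffun 'I_r -> bool}) (\prod_j (if b j then 1 else -1)) *
        choiceterm z r k (natfun false b) (natfun 0 x).
Proof.
move=> rN; pose y j := natfun 0 x j / z.
pose U j (d : nat) : K := y j ^+ ((k j.+1).+1 - dec_nw d).
pose L j (d : nat) : K := y j ^+ (k j + dec_ne d).
pose bu (b : {ffun 'I_r -> bool}) (j : nat) := (0 < j)%N && natfun false b j.-1.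
pose bl (b : {ffun 'I_r -> bool}) (j : nat) := (j < r)%N && ~~ natfun false b j.
pose c b j (d : 'I_4) : K := wt z d * z ^+ k j *
  ((if bu b j then U j.-1 d else 1) * (if bl b j then L j d else 1)).
have expand (d : decs) :
    \prod_(j < r) ((x j / z) ^+ ((k j.+1).+1 - dec_nw (natfun ord0 d j.+1)) -
       (x j / z) ^+ (k j + dec_ne (natfun ord0 d j))) =
    \sum_(b : {ffun 'I_r -> bool}) (\prod_j (if b j then 1 else -1)) *
      \prod_(j < r.+1) ((if bu b j then U j.-1 (natfun ord0 d j) else 1) *
         (if bl b j then L j (natfun ord0 d j) else 1)).
  pose F (j : 'I_r) (t : bool) : K :=
    if t then U j (natfun ord0 d j.+1) else - L j (natfun ord0 d j).
  transitivity (\prod_(j < r) \sum_t F j t).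
    by apply: eq_bigr => j _; rewrite big_bool /F /U /L /y natfunE.
  rewrite bigA_distr_bigA; apply: eq_bigr => b _ /=.
  rewrite [X in _ = _ * X]big_split /= big_ord_recl [X in _ * (_ * X)]big_ord_recr /=.
  rewrite {2}/bl ltnn mul1r mulr1 -!big_split /=; apply: eq_bigr => j _.
  rewrite /F /bu /bl /bump /= add1n /= natfunE ltn_ord /=.
  by case: (b j) => /=; rewrite ?mulr1 ?mul1r ?mulN1r.
under eq_bigr do rewrite expand mulr_sumr.
rewrite exchange_big; apply: eq_bigr => b _ /=.
have -> : choiceterm z r k (natfun false b) (natfun 0 x) = \prod_(j < r.+1) \sum_t c b j t.
  apply: eq_bigr => j _; apply: eq_bigr => t _; rewrite /c /U /L /y /bu.
  by case: ifP => // /andP [j0 _]; rewrite (prednK j0).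
rewrite -(sum_padded ord0 _ rN) mulr_sumr; apply: eq_bigr => d _.
have -> : \prod_(j < r.+1) c b j (natfun ord0 d j) =
    \prod_(j < r.+1) (wt z (natfun ord0 d j) * z ^+ k j) *
    \prod_(j < r.+1) ((if bu b j then U j.-1 (natfun ord0 d j) else 1) *
         (if bl b j then L j (natfun ord0 d j) else 1)) by rewrite -big_split.
by rewrite mulrCA -mulrA.
Qed.

Definition vdm (x : nat -> K) r : K := pairprod (fun p q : 'I_r => x q - x p).

Theorem operator_formula (x : nat -> K) r (k : entries) : (r <= N)%N ->
  (forall i, (i < N)%N -> x i != 0) ->
  (forall i j, (i < j)%N -> (j < N)%N -> x i != x j) ->
  padded ord0 r k -> incr r k ->
  agtp x r k * vdm x r = (\prod_(i < r) (1 + x i + (x i)^-1)) *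
     Wsum (fun i : 'I_r => natfun ord0 k i) (fun i : 'I_r => x i).
Proof.
move=> rN x0 xD; elim: r k rN => [|r IHr] k rN pk inck.
  rewrite /= pk /vdm /pairprod !big_ord0 /Wsum.
  rewrite (big_pred1 (1%g : 'S_0)) => [|s]; last by apply/esym/eqP/permP => -[].
  by rewrite odd_perm1 /pf /pairprod !big_ord0 !mulr1.
set z := x r; set xr := fun i : 'I_r => x i.
have z0 : z != 0 by apply: x0.
have xr0 p : xr p != 0 by apply: x0; apply: leq_trans (ltn_ord p) (ltnW rN).
have xz p : xr p != z by apply: xD.
set C := \prod_(i < r) (1 + x i + (x i)^-1).
have rN' : (r <= N)%N by apply: ltnW.
pose kn (j : nat) : nat := natfun ord0 k j.
have row (l : entries) (d : decs) : rowwt z r l k d * agtp x r l * vdm x r =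
    rowwt z r l k d * ((padded ord0 r l)%:R * (C * Wsum (fun i : 'I_r => natfun ord0 l i) xr)).
  have [-> | rw0] := eqVneq (rowwt z r l k d) 0; first by rewrite !mul0r.
  rewrite -mulrA; congr (_ * _).
  have [pl | npl] := boolP (padded ord0 r l); last by rewrite agtp_padded // !mul0r.
  by rewrite mul1r; apply: IHr => //; apply: rowwt_incr rw0.
have vdmS : vdm x r.+1 = vdm x r * \prod_(i < r) (z - x i).
  rewrite /vdm (pairprod_lift ord_max); congr (_ * _).
    by rewrite /pairprod; do 2![apply: eq_bigr => ? _]; rewrite !lift_max.
  by apply: eq_bigr => i _; rewrite lift_max ltn_ord.
pose A (d : decs) : K := (padded ord0 r.+1 d)%:R *
  \prod_(j < r.+1) (wt z (natfun ord0 d j) * z ^+ kn j).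
pose B (l : entries) (d : decs) : K := \prod_(j < r)
  (psi (kn j) (kn j.+1) (dec_ne (natfun ord0 d j)) (dec_nw (natfun ord0 d j.+1)) (natfun ord0 l j)
     * z ^- natfun ord0 l j).
(* The denominators of the geometric sums. Their product is symmetric in the variables, so it leaves
   the sum over permutations. *)
pose Q : K := \prod_(j < r) (x j / z - 1).
have Q0 : Q != 0.
  by apply/prodf_neq0 => i _; rewrite subr_eq0 -(inj_eq (mulIf z0)) mul1r divfK ?xz.
pose UL (s : 'S_r) (d : decs) : K := \prod_(j < r)
  ((xr (s j) / z) ^+ ((kn j.+1).+1 - dec_nw (natfun ord0 d j.+1)) -
   (xr (s j) / z) ^+ (kn j + dec_ne (natfun ord0 d j))).
have sumB (s : 'S_r) (d : decs) :
    \sum_(l : entries) (padded ord0 r l)%:R * (B l d * \prod_(j < r) xr (s j) ^+ natfun ord0 l j) =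
    Q^-1 * UL s d.
  under eq_bigr do rewrite -big_split /=.
  rewrite (@sum_row_below z r k d (xr \o s)) //; last by move=> p; apply: xz.
  rewrite big_split mulrC /=; congr (_ * _).
  by rewrite prodfV /Q [in RHS](reindex_inj (@perm_inj _ s)).
have sumE : agtp x r.+1 k * vdm x r =
    C * Q^-1 * \sum_(s : 'S_r) (-1) ^+ s * (pf (xr \o s) * \sum_d A d * UL s d).
  transitivity (\sum_(d : decs) \sum_(l : entries) \sum_(s : 'S_r)
      C * (((-1) ^+ s * pf (xr \o s)) * (A d *
       ((padded ord0 r l)%:R * (B l d * \prod_(j < r) xr (s j) ^+ natfun ord0 l j))))).
    rewrite /= -/z exchange_big mulr_suml; apply: eq_bigr => d _.
    rewrite mulr_suml; apply: eq_bigr => l _.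
    rewrite row /rowwt pk mul1r -/(A d) -/(B l d) /Wsum !mulr_sumr.
    have perm6 (a b p c e f g : K) :
      a * b * (p * (c * (e * (f * g)))) = c * ((e * f) * (a * (p * (b * g)))) by ring.
    by apply: eq_bigr => s _; apply: perm6.
  rewrite mulr_sumr; under eq_bigr do rewrite exchange_big.
  rewrite exchange_big; apply: eq_bigr => s _ /=.
  rewrite !mulr_sumr; apply: eq_bigr => d _.
  rewrite -!mulr_sumr sumB.
  have perm6 (a b c e f g : K) :
      c * ((e * f) * (a * (b * g))) = c * b * (e * (f * (a * g))) by ring.
  exact: perm6.
(* The new Vandermonde factors clear the denominators [Q], and the leftover power of [- z] cancels
   the prefactor of [branching]. *)
have prodz : \prod_(i < r) (z - x i) = Q * (- z) ^+ r.
  have -> : (- z) ^+ r = \prod_(i < r) (- z) by rewrite prodr_const card_ord.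
  rewrite /Q -big_split; apply: eq_bigr => i _ /=.
  by rewrite mulrBl mul1r mulrN divfK // opprK addrC.
have xrE : (fun i : 'I_r.+1 => x i) \o lift ord_max = xr.
  by apply: functional_extensionality => p; rewrite /comp lift_max.
have choice : \sum_(s : 'S_r) (-1) ^+ s * (pf (xr \o s) * \sum_d A d * UL s d) =
   (-1) ^+ r * (1 + z + z^-1) * z ^- r * Wsum (fun i : 'I_r.+1 => kn i) (fun i : 'I_r.+1 => x i).
  rewrite -(branching kn (X := fun i : 'I_r.+1 => x i)) => [|p]; last first.
    by apply: x0; apply: leq_trans (ltn_ord p) rN.
  rewrite xrE; apply: eq_bigr => s _; congr (_ * (_ * _)).
  by rewrite -(@sum_decorations _ _ kn (xr \o s)).
rewrite vdmS mulrA sumE prodz choice big_ord_recr /= -/C -/z [(- z) ^+ r]exprNn.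
set S := Wsum _ _; rewrite /kn -/S.
transitivity ((-1) ^+ r * (-1) ^+ r * (z ^- r * z ^+ r) * (Q^-1 * Q) * (C * (1 + z + z^-1) * S)).
  have perm9 (c q e t w v y s : K) :
      c * q * (e * t * w * s) * (y * (e * v)) = e * e * (w * v) * (q * y) * (c * t * s) by ring.
  exact: perm9.
have := signrMK r (1 : K); rewrite mulr1 => ->.
by rewrite !mulVf ?expf_neq0 // !mul1r.
Qed.

End OperatorFormula.

(** * A bounded Littlewood identity *)

Section LittlewoodDet.
Variable K : numFieldType.

(* The proof rests on [zz (1/x) = zz x / x^3] and [1 + zz (1/x) = (1 + zz x) / x^2]. *)
Definition zz (a : K) : K := a + a ^+ 2.
Definition ww (a : K) : K := zz a^-1.

(** The row factors [c] stay free because the recursion compares the determinants for [c x^2] and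
    [c x^3] with minors built from [c]. *)
Definition lwdet n (c x : 'I_n -> K) : K :=
  \det (\matrix_(i < n, j < n) (zz (x i) ^+ j - c i * ww (x i) ^+ j)).

(** Exactly what keeps [zz], [ww], [1 + zz] and [1 + ww] away from zero, so that the functions 1/v
    and 1/(1 + v) can be used as columns. *)
Definition regular (a : K) : bool := [&& a != 0, 1 + a != 0 & 1 + a + a ^+ 2 != 0].

Lemma zz_ww a : a != 0 -> zz a = a ^+ 3 * ww a.
Proof. by move=> a0; rewrite /ww /zz; field. Qed.

Lemma zz1_ww1 a : a != 0 -> 1 + zz a = a ^+ 2 * (1 + ww a).
Proof. by move=> a0; rewrite /ww /zz; field. Qed.

Lemma zz_neq0 a : regular a -> zz a != 0.
Proof. by case/and3P=> a0 a1 _; rewrite /zz -[X in X + _]mulr1 expr2 -mulrDr mulf_neq0. Qed.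

Lemma zz1_neq0 a : regular a -> 1 + zz a != 0.
Proof. by case/and3P=> _ _; rewrite /zz addrA. Qed.

Lemma ww_neq0 a : regular a -> ww a != 0.
Proof.
move=> ra; have := zz_neq0 ra; case/and3P: ra => a0 _ _.
by rewrite zz_ww // mulf_eq0 negb_or => /andP [].
Qed.

Lemma ww1_neq0 a : regular a -> 1 + ww a != 0.
Proof.
move=> ra; have := zz1_neq0 ra; case/and3P: ra => a0 _ _.
by rewrite zz1_ww1 // mulf_eq0 negb_or => /andP [].
Qed.

Section Recursion.
Variables (n : nat) (c x : 'I_n.+1 -> K).
Hypothesis xreg : forall i, regular (x i).

(** The sum of [T i f * minor i] is the expansion, along its last column, of the determinant with
    columns v^0, ..., v^(n-1) and [f]; it is linear in [f] and kills polynomials of degree below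
    n. *)
Let T i (f : K -> K) : K := f (zz (x i)) - c i * f (ww (x i)).

Let minor (i : 'I_n.+1) : K := (-1) ^+ (i + n) * lwdet (c \o lift i) (x \o lift i).

Lemma minor_pow j : (j < n)%N -> \sum_i T i (fun v => v ^+ j) * minor i = 0.
Proof.
move=> jn; pose e (l : 'I_n.+1) : nat := if (l < n)%N then nat_of_ord l else j.
pose B := \matrix_(i < n.+1, l < n.+1) T i (fun v => v ^+ e l).
have: \det B = 0.
  rewrite -det_tr; have jn1 : (j < n.+1)%N by apply: ltnW.
  apply: (@determinant_alternate _ _ _ (Ordinal jn1) ord_max).
    by rewrite -val_eqE /=; lia.
  by move=> l; rewrite !mxE /e /= jn ltnn.
rewrite (expand_det_col _ ord_max) => B0; apply: etrans B0; apply: eq_bigr => i _.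
rewrite mxE /e /= ltnn; congr (_ * _); rewrite /minor /cofactor; congr (_ * \det _).
by apply/matrixP => p l; rewrite !mxE /e lift_max ltn_ord.
Qed.

Lemma minor_poly (h : {poly K}) : (size h <= n)%N ->
  \sum_i T i (fun v => h.[v]) * minor i = 0.
Proof.
move=> sh; transitivity (\sum_(j < size h) h`_j * \sum_i T i (fun v => v ^+ j) * minor i).
  under [RHS]eq_bigr do rewrite mulr_sumr.
  rewrite exchange_big; apply: eq_bigr => i _.
  rewrite /T !horner_coef mulr_sumr -sumrB mulr_suml; apply: eq_bigr => j _ /=.
  by ring.
by rewrite big1 // => j _; rewrite minor_pow ?mulr0 // (leq_trans _ sh).
Qed.

Lemma minor_scale (t : 'I_n.+1 -> K) (f : K -> K) :
  (\prod_i t i) * (\sum_i T i f * minor i) =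
  \sum_i (t i * T i f) * ((-1) ^+ (i + n) *
     \det (\matrix_(p < n, j < n) (t (lift i p) * T (lift i p) (fun v => v ^+ j)))).
Proof.
rewrite mulr_sumr; apply: eq_bigr => i _; rewrite (bigD1_ord i) //= /minor.
have -> : \matrix_(p < n, j < n) (t (lift i p) * T (lift i p) (fun v => v ^+ j)) =
    diag_mx (\row_p t (lift i p)) *m
      \matrix_(p < n, j < n) (zz (x (lift i p)) ^+ j - c (lift i p) * ww (x (lift i p)) ^+ j).
  by rewrite mul_diag_mx; apply/matrixP => p j; rewrite !mxE.
rewrite det_mulmx det_diag -/(lwdet (c \o lift i) (x \o lift i)).
under [X in _ = _ * (_ * (X * _))]eq_bigr do rewrite mxE.
have perm5 (a b d e f' : K) : a * b * (d * (e * f')) = a * d * (e * (b * f')) by ring.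
exact: perm5.
Qed.

(** Scaling row i by [zz (x i)], which is x^3 times [ww (x i)], turns the columns 1/v, 1, v, ...
    into 1, v, v^2, ... and [c] into [c x^3]. The sign comes from moving the last column to the
    front. *)
Lemma minor_inv : (\prod_i zz (x i)) * (\sum_i T i (fun v => v^-1) * minor i) =
  (-1) ^+ n * lwdet (fun i => c i * x i ^+ 3) x.
Proof.
rewrite minor_scale /lwdet (expand_det_col _ ord0) mulr_sumr; apply: eq_bigr => i _.
have rz := xreg i; rewrite mxE /cofactor addn0 exprD !expr0 mulr1.
have -> : zz (x i) * T i (fun v => v^-1) = 1 - c i * x i ^+ 3.
  rewrite /T; have := ww_neq0 rz; case/and3P: (rz) => a0 _ _ w0.
  by rewrite zz_ww //; field; rewrite w0 a0.
have -> : row' i (col' ord0 (\matrix_(i0, j) (zz (x i0) ^+ j - c i0 * x i0 ^+ 3 * ww (x i0) ^+ j)))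
  = \matrix_(p < n, j < n) (zz (x (lift i p)) * T (lift i p) (fun v => v ^+ j)).
  apply/matrixP => p j; rewrite !mxE lift0 /T.
  have /and3P [a0 _ _] := xreg (lift i p).
  by rewrite !exprS zz_ww //; ring.
by ring.
Qed.

(** As for [minor_inv], with scaling by 1 + zz, which is x^2 (1 + ww). The resulting columns 1, 1 +
    v, v (1 + v), ... differ from the powers by the unitriangular matrix [U]. *)
Lemma minor_inv1 : (\prod_i (1 + zz (x i))) * (\sum_i T i (fun v => (1 + v)^-1) * minor i) =
  (-1) ^+ n * lwdet (fun i => c i * x i ^+ 2) x.
Proof.
pose c' i := c i * x i ^+ 2.
pose A := \matrix_(i < n.+1, j < n.+1) (zz (x i) ^+ j - c' i * ww (x i) ^+ j).
pose U := \matrix_(i < n.+1, j < n.+1) ((i == j) || (i.+1 == j))%:R : 'M[K]_n.+1.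
have detU : \det U = 1.
  rewrite -det_tr det_trig; last first.
    by apply/is_trig_mxP => i j ij; rewrite !mxE; case: eqP => [E|_]; [move: ij; rewrite E; lia|]; case: eqP => //; lia.
  by rewrite big1 // => i _; rewrite !mxE eqxx.
have -> : lwdet c' x = \det (A *m U) by rewrite det_mulmx detU mulr1.
have AU0 i : (A *m U) i ord0 = 1 - c' i.
  rewrite mxE (bigD1 ord0) //= big1 => [|l l0]; first by rewrite !mxE /= mulr1 addr0 mulr1.
  by rewrite !mxE (negPf l0) mulr0.
have AUS i (j : 'I_n) : (A *m U) i (lift ord0 j) =
    zz (x i) ^+ j * (1 + zz (x i)) - c' i * (ww (x i) ^+ j * (1 + ww (x i))).
  have jn : (j < n.+1)%N by apply: leq_trans (ltn_ord j) _.
  rewrite mxE (bigD1 (lift ord0 j)) //= (bigD1 (Ordinal jn)) /=; last first.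
    by rewrite -val_eqE /= /bump /=; lia.
  rewrite big1 => [|l /andP [l1 l2]].
    rewrite !mxE eqxx /= /bump /= add1n eqxx orbT !exprS !mulr1; ring.
  rewrite !mxE (negPf l1) /= /bump /= add1n eqSS.
  by move: l2; rewrite -val_eqE /= => /negPf ->; rewrite mulr0.
rewrite minor_scale (expand_det_col _ ord0) mulr_sumr; apply: eq_bigr => i _.
have rz := xreg i; rewrite AU0 /cofactor addn0 exprD.
have -> : (1 + zz (x i)) * T i (fun v => (1 + v)^-1) = 1 - c' i.
  rewrite /T /c'; have := ww1_neq0 rz; case/and3P: (rz) => a0 _ _ w0.
  by rewrite zz1_ww1 //; field; rewrite w0 a0.
have -> : row' i (col' ord0 (A *m U))
  = \matrix_(p < n, j < n) ((1 + zz (x (lift i p))) * T (lift i p) (fun v => v ^+ j)).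
  apply/matrixP => p j; rewrite 2!mxE AUS mxE /T /c'.
  have /and3P [a0 _ _] := xreg (lift i p).
  by rewrite zz1_ww1 //; ring.
by ring.
Qed.

(** Divided by v (1 + v), this is the partial fraction decomposition with poles 0 and -1. The size
    bound puts the polynomial part [h] within reach of [minor_poly]. *)
Lemma partial_fraction (P : {poly K}) m : (size P <= m.+2)%N ->
  exists2 h : {poly K}, (size h <= m)%N &
    P = h * 'X * (1 + 'X) + P.[0] *: (1 + 'X) - P.[-1] *: 'X.
Proof.
move=> sP; pose Q := P - P.[0] *: (1 + 'X) + P.[-1] *: 'X.
have r0 : root Q 0 by rewrite /root !hornerE; apply/eqP; ring.
have [h1 Q1] := factor_theorem _ _ r0.
have r1 : root h1 (-1).
  have : root Q (-1) by rewrite /root !hornerE; apply/eqP; ring.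
  by rewrite Q1 rootM root_XsubC oppr_eq0 oner_eq0 orbF.
have [h E1] := factor_theorem _ _ r1; exists h; last first.
  have : Q = h * 'X * (1 + 'X) by rewrite Q1 E1 polyCN polyC1 polyC0; ring.
  by rewrite /Q => <-; ring.
have sQ : (size Q <= m.+2)%N.
  have s1 : (size (1 + 'X : {poly K})%R <= m.+2)%N by rewrite addrC -polyC1 size_XaddC.
  rewrite (leq_trans (size_polyD _ _)) // geq_max (leq_trans (size_polyD _ _)) ?geq_max ?sP ?size_polyN /=.
    by rewrite (leq_trans (size_scale_leq _ _)) // size_polyX.
  by rewrite (leq_trans (size_scale_leq _ _)).
have [-> | h0] := eqVneq h 0; first by rewrite size_poly0.
have : size Q = (size h).+2.
  by rewrite Q1 E1 !size_Mmonic ?monicXsubC ?mulf_neq0 ?polyXsubC_eq0 // !size_XsubC !addn2.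
by move=> sQh; move: sQ; rewrite sQh.
Qed.

(* Apply the extra column to [prod_p (zz (x p) - v) / (v (1 + v))]: it vanishes
   at every [v = zz (x i)], and its partial fractions in 0 and -1 give the two
   determinants on the left. *)
Lemma lwdet_diff :
  lwdet (fun i => c i * x i ^+ 3) x - lwdet (fun i => c i * x i ^+ 2) x =
  \sum_i c i * x i ^+ 2 * (1 - x i) * (\prod_(p < n) (ww (x i) - zz (x (lift i p)))) *
    minor i.
Proof.
pose P : {poly K} := \prod_i ((zz (x i))%:P - 'X).
have PE v : P.[v] = \prod_i (zz (x i) - v).
  by rewrite /P horner_prod; apply: eq_bigr => i _; rewrite !hornerE.
have sP : (size P <= n.+2)%N.
  rewrite /P; apply: leq_trans (size_prod_leq _ _) _.
  rewrite (eq_bigr (fun=> 2%N)) => [|i _]; last first.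
    by rewrite -opprB size_polyN size_XsubC.
  by rewrite sum_nat_const card_ord; lia.
have [h sh Ph] := partial_fraction sP.
pose g v := P.[v] / (v * (1 + v)).
have gE v : v != 0 -> 1 + v != 0 -> g v = h.[v] + P.[0] * v^-1 + - P.[-1] * (1 + v)^-1.
  move=> v0 v1; rewrite /g {1}Ph !hornerE; field; by rewrite v0 v1.
have Tg i : T i g = T i (fun v => h.[v]) + P.[0] * T i (fun v => v^-1)
      + - P.[-1] * T i (fun v => (1 + v)^-1).
  have lin (e h1 h2 a1 a2 b1 b2 a b : K) :
    h1 + a * a1 + b * b1 - e * (h2 + a * a2 + b * b2) =
    h1 - e * h2 + a * (a1 - e * a2) + b * (b1 - e * b2) by ring.
  by rewrite /T !gE ?ww_neq0 ?ww1_neq0 ?zz_neq0 ?zz1_neq0 //; apply: lin.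
have sumT : \sum_i T i g * minor i =
    (-1) ^+ n * (lwdet (fun i => c i * x i ^+ 3) x - lwdet (fun i => c i * x i ^+ 2) x).
  under eq_bigr do rewrite Tg 2!mulrDl -!mulrA.
  rewrite 2!big_split /= minor_poly // add0r -!mulr_sumr mulrBr -minor_inv -minor_inv1.
  rewrite !PE mulNr; congr (_ * _ - _ * _); apply: eq_bigr => i _; first by rewrite subr0.
  by rewrite opprK addrC.
have sgn2 : (-1) ^+ n * (-1) ^+ n = 1 :> K.
  by have := signrMK n (1 : K); rewrite mulr1.
rewrite -[LHS]mul1r -[X in X * _ = _]sgn2 -mulrA -sumT mulr_sumr; apply: eq_bigr => i _.
have rz := xreg i; have /and3P [a0 a1 a2] := rz.
have w0 := ww_neq0 rz; have w1 := ww1_neq0 rz.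
have -> : T i g = - c i * g (ww (x i)).
  by rewrite /T {1}/g PE (bigD1 i) //= subrr !mul0r sub0r mulNr.
rewrite /g PE (bigD1_ord i) //=.
have -> : zz (x i) - ww (x i) = ww (x i) * (1 + ww (x i)) * (x i ^+ 2 * (x i - 1)).
  by rewrite /ww /zz; field.
have -> : \prod_(p < n) (zz (x (lift i p)) - ww (x i)) =
   (-1) ^+ n * \prod_(p < n) (ww (x i) - zz (x (lift i p))).
  have -> : (-1) ^+ n = \prod_(p < n) (-1) :> K by rewrite prodr_const card_ord.
  rewrite -big_split.
  by apply: eq_bigr => p _; rewrite /= mulN1r opprB.
set P1 := \prod_(p < n) _.
have fin (e w u a b d : K) : w != 0 -> u != 0 -> e * e = 1 ->
  e * ((- a * (w * u * (b * d) * (e * P1) / (w * u))) * minor i) = a * b * (- d) * P1 * minor i.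
  move=> w_0 u_0 ee.
  have -> : e * ((- a * (w * u * (b * d) * (e * P1) / (w * u))) * minor i) =
    (e * e) * (a * b * (- d) * P1 * minor i) by field; rewrite w_0 u_0.
  by rewrite ee mul1r.
by rewrite fin // opprB.
Qed.

End Recursion.

End LittlewoodDet.
Section BoundedLittlewood.
Variable K : numFieldType.

(* The sum of [y_0^k_0 ... y_(n-1)^k_(n-1)] over [k_0 < ... < k_(n-1) < M]. *)
Fixpoint strictsum (y : nat -> K) (n M : nat) : K :=
  if n is n'.+1 then \sum_(v < M) y n' ^+ v * strictsum y n' v else 1.

Lemma strictsum_ext y1 y2 n M :
  (forall i, (i < n)%N -> y1 i = y2 i) -> strictsum y1 n M = strictsum y2 n M.
Proof.
elim: n M => //= n IHn M y12; apply: eq_bigr => v _.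
by rewrite y12 // IHn // => i ile; apply: y12; apply: ltnW.
Qed.

Lemma strictsumS y n M :
  strictsum y n.+1 M.+1 = strictsum y n.+1 M + y n ^+ M * strictsum y n M.
Proof. exact: big_ord_recr. Qed.

Definition littlewoodsum n M (x : 'I_n -> K) : K :=
  \sum_(s : 'S_n) (-1) ^+ s * (pf (x \o s) * strictsum (natfun 0 (x \o s)) n M).

Lemma littlewoodsum0 n (x : 'I_n.+1 -> K) : littlewoodsum 0 x = 0.
Proof. by rewrite /littlewoodsum big1 // => s _; rewrite /= big_ord0 !mulr0. Qed.

Lemma littlewoodsumS n M (x : 'I_n.+1 -> K) :
  littlewoodsum M.+1 x = littlewoodsum M x +
  \sum_(j < n.+1) (-1) ^+ (j + n) * (x j ^+ M * \prod_(p < n) pairfac (x (lift j p)) (x j)) *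
    littlewoodsum M (x \o lift j).
Proof.
rewrite /littlewoodsum; under eq_bigr do rewrite strictsumS !mulrDr.
rewrite big_split /=; congr (_ + _).
rewrite (sum_sign_expand_row ord_max); apply: eq_bigr => j _.
rewrite addnC -mulrA; congr (_ * _); rewrite mulr_sumr; apply: eq_bigr => t _.
rewrite -[n in natfun _ _ n]/(val (@ord_max n)) natfunE /= lift_perm_id.
have -> : pf (x \o lift_perm ord_max j t) =
    pf ((x \o lift j) \o t) * \prod_(p < n) pairfac (x (lift j p)) (x j).
  rewrite /pf (pairprod_lift ord_max); congr (_ * _).
    by rewrite /pairprod; do 2![apply: eq_bigr => ? _]; rewrite /= !lift_perm_lift.
  rewrite [RHS](reindex_inj (@perm_inj _ t)); apply: eq_bigr => p _.
  by rewrite lift_max ltn_ord /comp lift_perm_id lift_perm_lift.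
rewrite (@strictsum_ext _ (natfun 0 ((x \o lift j) \o t))); last first.
  move=> i ile.
  have E1 := natfunE 0 (x \o lift_perm ord_max j t) (lift ord_max (Ordinal ile)).
  have E2 := natfunE 0 ((x \o lift j) \o t) (Ordinal ile).
  by rewrite lift_max in E1; rewrite [LHS]E1 [RHS]E2 /comp lift_perm_lift.
have perm5 (e f p u s : K) : e * (f * p * (u * s)) = u * p * (e * (f * s)) by ring.
by rewrite perm5.
Qed.

(** The columns are dependent with binomial coefficients, because (1 + zz)^n = x^(2n) (1 + ww)^n.
    This is the start M = 0 of the induction, where no strict sequence exists. *)
Lemma lwdet0 n (x : 'I_n.+1 -> K) : (forall i, regular (x i)) ->
  lwdet (fun i => x i ^+ n.*2) x = 0.
Proof.
move=> xreg; apply/eqP; rewrite /lwdet -det_tr; apply/det0P.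
exists (\row_(j < n.+1) 'C(n, j)%:R).
  apply/eqP => /rowP /(_ ord0); rewrite !mxE bin0 => /eqP; by rewrite oner_eq0.
apply/rowP => i; rewrite !mxE; under eq_bigr do rewrite !mxE.
have E (v : K) : \sum_(j < n.+1) 'C(n, j)%:R * v ^+ j = (1 + v) ^+ n.
  by rewrite exprDn; apply: eq_bigr => j _; rewrite expr1n mul1r mulr_natl.
transitivity (\sum_(j < n.+1) 'C(n, j)%:R * zz (x i) ^+ j -
   x i ^+ n.*2 * \sum_(j < n.+1) 'C(n, j)%:R * ww (x i) ^+ j).
  by rewrite mulr_sumr -sumrB; apply: eq_bigr => j _; ring.
have /and3P [a0 _ _] := xreg i.
by rewrite !E zz1_ww1 // exprMn -exprM mul2n subrr.
Qed.

(** The reason for multiplying by 1 - x_p x_q: it converts the pair factors of [littlewoodsumS] into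
    the differences of [lwdet_diff]. *)
Lemma pairfac_ww (a b : K) : b != 0 ->
  pairfac a b * (1 - a * b) = b ^+ 2 * (ww b - zz a).
Proof. by move=> b0; rewrite /pairfac /ww /zz; field. Qed.

(** The exponent is M + 2n - 2, written as a quotient because natural subtraction would truncate it
    when n = 0. *)
Theorem bounded_littlewood n M (x : 'I_n -> K) : (forall i, regular (x i)) ->
  littlewoodsum M x * (\prod_i (1 - x i) * pairprod (fun p q => 1 - x p * x q)) =
  lwdet (fun i => x i ^+ (M + n.*2) / x i ^+ 2) x.
Proof.
elim: M n x => [|M IHM] [|n] x xreg.
- rewrite /lwdet det_mx00 /pairprod !big_ord0 /littlewoodsum.
  rewrite (big_pred1 (1%g : 'S_0)) => [|s]; last by apply/esym/eqP/permP => -[].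
  by rewrite odd_perm1 /pf /pairprod !big_ord0 !mulr1.
- rewrite littlewoodsum0 mul0r -(lwdet0 xreg) /lwdet; congr (\det _).
  apply/matrixP => i j; rewrite !mxE; have /and3P [a0 _ _] := xreg i.
  by rewrite add0n doubleS -addn2 exprD mulfK // expf_neq0.
- rewrite /lwdet det_mx00 /pairprod !big_ord0 /littlewoodsum.
  rewrite (big_pred1 (1%g : 'S_0)) => [|s]; last by apply/esym/eqP/permP => -[].
  by rewrite odd_perm1 /pf /pairprod !big_ord0 !mulr1.
(* [c] is the row factor for n variables at M. For n + 1 variables, [c x^2] belongs to M and [c x^3]
   to M + 1, which are the three terms of [lwdet_diff]. *)
pose c i := x i ^+ (M + n.*2) / x i ^+ 2.
have cE e (p : nat) : p = (M + n.*2 + e)%N ->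
    lwdet (fun i => x i ^+ (p + 2) / x i ^+ 2) x = lwdet (fun i => c i * x i ^+ e.+2) x.
  move=> ->; rewrite /lwdet; congr (\det _); apply/matrixP => i j; rewrite !mxE.
  have /and3P [a0 _ _] := xreg i; congr (_ - _ * _).
  by rewrite /c !exprD !exprS expr0; field.
have -> : (M.+1 + n.+1.*2 = M + n.*2 + 1 + 2)%N by rewrite doubleS; lia.
rewrite (cE 1%N) //.
have := lwdet_diff c xreg; move/eqP; rewrite subr_eq => /eqP ->.
rewrite -(cE 0%N _ (esym (addn0 _))).
have -> : (M + n.*2 + 2 = M + n.+1.*2)%N by rewrite doubleS; lia.
rewrite -IHM // littlewoodsumS mulrDl addrC; congr (_ + _).
rewrite mulr_suml; apply: eq_bigr => i _.
rewrite -IHM; last by move=> p; apply: xreg.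
rewrite (bigD1_ord i) //= (pairprod_lift i).
have -> : \prod_(p < n) (if (lift i p < i)%N then 1 - x (lift i p) * x i
    else 1 - x i * x (lift i p)) = \prod_(p < n) (1 - x (lift i p) * x i).
  by apply: eq_bigr => p _; rewrite [x i * _]mulrC; case: ifP.
have /and3P [a0 _ _] := xreg i.
have := erefl (\prod_(p < n) (pairfac (x (lift i p)) (x i) * (1 - x (lift i p) * x i))).
rewrite {1}big_split /=; under [X in _ = X -> _]eq_bigr do rewrite pairfac_ww //.
rewrite [X in _ = X -> _]big_split /= prodr_const card_ord => key.
have cx : c i * x i ^+ 2 = x i ^+ M * x i ^+ 2 ^+ n.
  by rewrite /c divfK ?expf_neq0 // exprD -exprM mul2n.
rewrite cx; set W := \prod_(p < n) (ww _ - _) in key *.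
set P1 := \prod_(p < n) pairfac _ _ in key *; set P2 := \prod_(p < n) (1 - x (lift i p) * x i) in key *.
set P3 := \prod_(p < n) _; set P4 := pairprod _; set L := littlewoodsum _ _.
have fin (e u l o p1 p2 p3 p4 y w : K) : p1 * p2 = y * w ->
    e * (u * p1) * l * (o * p3 * (p4 * p2)) = u * y * o * w * (e * (l * (p3 * p4))).
  move=> pE; have -> : u * y * o * w * (e * (l * (p3 * p4))) =
    u * o * (y * w) * (e * (l * (p3 * p4))) by ring.
  by rewrite -pE; ring.
exact: fin key.
Qed.

End BoundedLittlewood.

(** * From patterns to the row recursion *)

Lemma sum_option (V : nmodType) (T : finType) (F : option T -> V) :
  \sum_o F o = F None + \sum_t F (Some t).
Proof.
rewrite (bigD1 None) //=; congr (_ + _).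
rewrite (reindex_omap (Some : T -> option T) id) /=; last by case.
by apply: eq_bigl => t; rewrite eqxx.
Qed.

Lemma sum_ffun_ordS (V : nmodType) (T : finType) n (F : {ffun 'I_n.+1 -> T} -> V) :
  \sum_f F f = \sum_t \sum_(g : {ffun 'I_n -> T})
    F [ffun i => if unlift ord_max i is Some j then g j else t].
Proof.
rewrite pair_big /=; pose h (u : T * {ffun 'I_n -> T}) : {ffun 'I_n.+1 -> T} :=
  [ffun i => if unlift ord_max i is Some j then u.2 j else u.1].
rewrite (reindex h) //=.
exists (fun f : {ffun 'I_n.+1 -> T} => (f ord_max, [ffun j => f (lift ord_max j)])).
  move=> [t g] _; rewrite /h /= ffunE unlift_none; congr (_, _).
  by apply/ffunP => j; rewrite !ffunE liftK.
move=> f _; apply/ffunP => i; rewrite /h ffunE /=.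
by case: unliftP => [j|] ->; rewrite ?ffunE.
Qed.

Section TransferChains.
Variables (R : comNzRingType) (T : finType).

(** A transfer-matrix product: the total weight of the sequences of [r] states that end in [o],
    where [None] stands for the position before the first state. *)
Fixpoint chain (phi : nat -> option T -> T -> R) (r : nat) (o : option T) : R :=
  match r, o with
  | 0, _ => (o == None)%:R
  | r'.+1, Some t => \sum_o' phi r' o' t * chain phi r' o'
  | _.+1, None => 0
  end.

Definition before n (f : 'I_n -> T) (i : nat) : option T :=
  if i is j.+1 then omap f (insub j) else None.

(** The final weight [chi] is arbitrary so that the induction can absorb the last transition into
    it. *)
Lemma sum_chain n (phi : nat -> option T -> T -> R) (chi : option T -> R) :
  \sum_(f : {ffun 'I_n -> T}) (\prod_(i < n) phi i (before f i) (f i)) * chi (before f n) =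
  \sum_o chi o * chain phi n o.
Proof.
elim: n chi => [|n IHn] chi.
  rewrite sum_option [X in _ + X]big1 => [|t _]; last by rewrite /= mulr0.
  rewrite /= mulr1 addr0.
  have f0 : 'I_0 -> T by case.
  rewrite (big_pred1 [ffun i => f0 i]) ?big_ord0 ?mul1r // => f.
  by apply/esym/eqP/ffunP => -[].
rewrite sum_ffun_ordS sum_option /= mulr0 add0r; apply: eq_bigr => t _.
rewrite mulr_sumr; under [RHS]eq_bigr do rewrite mulrA.
rewrite -(IHn (fun o => chi (Some t) * phi n o t)); apply: eq_bigr => g _.
set f := [ffun i => _].
have fl (j : 'I_n) : f (lift ord_max j) = g j by rewrite ffunE liftK.
have fm : f ord_max = t by rewrite ffunE unlift_none.
have bf i : (i <= n)%N -> before f i = before g i.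
  case: i => //= j jn; have jn1 : (j < n.+1)%N by apply: ltnW.
  rewrite (insubT (fun j => j < n.+1)%N jn1) (insubT (fun j => j < n)%N jn) /= -fl.
  by congr (Some (f _)); apply/val_inj; rewrite /= /bump; lia.
have -> : omap f (insub n) = Some t.
  by rewrite -[n in LHS]/(val (@ord_max n)) valK /= fm.
rewrite big_ord_recr /= -[n in before f n]/(val (@ord_max n)) /= bf //.
have -> : f ord_max = t by [].
under eq_bigr => i _.
  rewrite (_ : f _ = g i) ?bf; [over | exact: ltnW | ].
  by rewrite -fl; congr (f _); apply/val_inj; rewrite /= /bump leqNgt ltn_ord.
by rewrite /= -!mulrA; congr (_ * _); rewrite mulrC.
Qed.

End TransferChains.

Section Patterns.
Variables (K : numFieldType) (n m : nat).
Local Notation entries := {ffun 'I_n -> 'I_m.+1}.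
Local Notation decs := {ffun 'I_n -> 'I_4}.
Local Notation row := (entries * decs)%type.

Definition rowok r (l k : entries) (d : decs) : bool :=
  [&& padded ord0 r.+1 k, padded ord0 r.+1 d, [forall j : 'I_r.+1, natfun ord0 d j != 3 :> nat]
    & [forall j : 'I_r, psiok (natfun ord0 k j) (natfun ord0 k j.+1) (dec_ne (natfun ord0 d j))
         (dec_nw (natfun ord0 d j.+1)) (natfun ord0 l j)]].

Definition rowspecial r (l k : entries) (d : decs) : nat :=
  (\sum_(j < r) psispecial (natfun ord0 k j) (natfun ord0 k j.+1) (dec_ne (natfun ord0 d j))
         (dec_nw (natfun ord0 d j.+1)) (natfun ord0 l j))%N.

Lemma rowwt1 r l k d :
  rowwt 1 r l k d = (-1) ^+ rowspecial r l k d * (rowok r l k d)%:R :> K.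
Proof.
rewrite /rowwt /rowok -!mulnb !natrM !natr_forall /rowspecial -prodrXr.
have -> : \prod_(j < r) (psi K (natfun ord0 k j) (natfun ord0 k j.+1) (dec_ne (natfun ord0 d j))
    (dec_nw (natfun ord0 d j.+1)) (natfun ord0 l j) * 1 ^- natfun ord0 l j) =
  \prod_(j < r) psi K (natfun ord0 k j) (natfun ord0 k j.+1) (dec_ne (natfun ord0 d j))
    (dec_nw (natfun ord0 d j.+1)) (natfun ord0 l j).
  by apply: eq_bigr => j _; rewrite expr1n invr1 mulr1.
have -> : \prod_(j < r.+1) (wt (1 : K) (natfun ord0 d j) * 1 ^+ natfun ord0 k j) =
  \prod_(j < r.+1) (natfun ord0 d j != 3 :> nat)%:R.
  apply: eq_bigr => j _; rewrite expr1n mulr1 /wt invr1.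
  by case: (natfun ord0 d j) => -[|[|[|[|]]]].
rewrite /psi big_split /=.
have perm5 (a b c s o : K) : a * b * c * (s * o) = s * (a * (b * (c * o))) by ring.
exact: perm5.
Qed.

(** The zero row is the only row padded to length 0, so it is the one that [agtp] places above the
    first row. *)
Definition transfer r (o : option row) (t : row) : K :=
  rowwt 1 r (if o is Some u then u.1 else [ffun=> ord0]) t.1 t.2.

Lemma chain_agtp r k : \sum_d chain transfer r.+1 (Some (k, d)) = agtp (fun=> 1) r.+1 k.
Proof.
elim: r k => [|r IHr] k; rewrite [RHS]/= [RHS]exchange_big; apply: eq_bigr => d _.
  rewrite [LHS]/= sum_option [X in _ + X]big1 ?addr0 => [|t _]; last by rewrite mulr0.
  rewrite mulr1 (bigD1 [ffun=> ord0]) //= big1 ?addr0 => [|l l0].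
    rewrite /transfer /= (_ : padded _ _ _) ?mulr1 //.
    by apply/forallP => j; rewrite ffunE eqxx implybT.
  have [/forallP pl | //] := boolP (padded ord0 0 l); last by rewrite mulr0.
  case/eqP: l0; apply/ffunP => j; rewrite ffunE.
  by have /eqP := pl j.
rewrite [LHS]/= sum_option mulr0 add0r.
have -> : forall F : row -> K, \sum_u F u = \sum_l \sum_d' F (l, d').
  by move=> F; rewrite pair_bigA; apply: eq_bigr => -[].
apply: eq_bigr => l _; transitivity (rowwt 1 r.+1 l k d * agtp (fun=> 1 : K) r.+1 l) => //.
by rewrite -IHr mulr_sumr; apply: eq_bigr.
Qed.

Definition pat_of_rows (f : {ffun 'I_n -> row}) : Pat n m :=
  ([ffun u => (f u.1).1 u.2], [ffun u => (f u.1).2 u.2]).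

Lemma pat_of_rows_bij : bijective pat_of_rows.
Proof.
exists (fun P : Pat n m => [ffun i => ([ffun j => P.1 (i, j)], [ffun j => P.2 (i, j)])]).
  move=> f; apply/ffunP => i; rewrite ffunE [RHS]surjective_pairing.
  by congr (_, _); apply/ffunP => j; rewrite !ffunE.
by case=> P Q; congr (_, _); apply/ffunP => -[i j]; rewrite !ffunE.
Qed.

Section FixRows.
Variable f : {ffun 'I_n -> row}.
Let P := pat_of_rows f.
Let prev (i : nat) : entries := if before f i is Some u then u.1 else [ffun=> ord0].

Lemma ent_rows (i : 'I_n) (j : nat) : ent P i j = natfun ord0 (f i).1 j.
Proof. by rewrite /ent valK /natfun; case: insub => // j'; rewrite ffunE. Qed.

Lemma dec_rows (i : 'I_n) (j : nat) : dec P i j = natfun ord0 (f i).2 j.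
Proof. by rewrite /dec valK /natfun; case: insub => // j'; rewrite ffunE. Qed.

Lemma prev_rows (i j : nat) : (0 < i)%N -> (i <= n)%N -> natfun ord0 (prev i) j = ent P i.-1 j :> nat.
Proof.
case: i => //= i _ ile; rewrite -[i in RHS]/(val (Ordinal ile)) ent_rows.
by rewrite /prev /= (insubT (fun i => i < n)%N ile) /=.
Qed.

Lemma rowsok : [forall i : 'I_n, rowok i (prev i) (f i).1 (f i).2] =
  arrowed_GT P && no_double P.
Proof.
have e_out (i j : nat) : (n <= j)%N -> dec P i j = 0%N.
  move=> nj; rewrite /dec; case: insub => // i'; by rewrite insubN // -leqNgt.
apply/forallP/andP => [ok | [/and3P [/forallP tri /forallP gt /forallP arr] /forallP nd] i].
  have psi_ok (i j : nat) : (j < i)%N -> (i < n)%N ->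
      psiok (ent P i j) (ent P i j.+1) (dec_ne (dec P i j)) (dec_nw (dec P i j.+1)) (ent P i.-1 j).
    move=> ji ile; case/and4P: (ok (Ordinal ile)) => _ _ _ /forallP /(_ (Ordinal ji)).
    by rewrite /= -ent_rows -ent_rows -!dec_rows prev_rows //; lia.
  have tri : triangular P.
    apply/forallP => i; apply/forallP => j; apply/implyP => ij.
    case/and4P: (ok i) => /forallP /(_ j) /implyP h1 /forallP /(_ j) /implyP h2 _ _.
    by rewrite !ffunE /= h1 // h2.
  split; last first.
    apply/forallP => i; apply/forallP => j; have [ji|ij] := leqP j i.
      case/and4P: (ok i) => _ _ /forallP /(_ (Ordinal (ji : j < i.+1)%N)) h _.
      by rewrite dec_rows.
    rewrite dec_rows natfunE; move/forallP: tri => /(_ i) /forallP /(_ j) /implyP /(_ ij).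
    by rewrite !ffunE /= => /andP [_ /eqP ->].
  apply/and3P; split => //.
    apply/forallP => i; apply/forallP => j; apply/implyP => /andP [ji i1].
    by have /and4P [-> -> _ _] := psi_ok i.+1 j ji i1.
  apply/forallP => i; apply/forallP => j; apply/implyP => ji; apply/andP; split.
    apply/implyP => /andP [/andP [/andP [i0 jlt] e1] ne].
    have /and4P [_ _ h _] := psi_ok i j jlt (ltn_ord i).
    by move: h; rewrite eq_sym e1 ne.
  apply/implyP => /andP [/andP [/andP [i0 j0] e1] nw].
  have jlt : (j.-1 < i)%N by lia.
  have /and4P [_ _ _ h] := psi_ok i j.-1 jlt (ltn_ord i).
  move: h; rewrite prednK // eq_sym e1 nw /= eq_sym; by rewrite [X in X && _]eq_sym.
apply/and4P; split.
- apply/forallP => j; apply/implyP => ij.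
  by move/forallP: (tri i) => /(_ j) /implyP /(_ ij); rewrite !ffunE /= => /andP [].
- apply/forallP => j; apply/implyP => ij.
  by move/forallP: (tri i) => /(_ j) /implyP /(_ ij); rewrite !ffunE /= => /andP [].
- apply/forallP => j; have jn : (j < n)%N by have := ltn_ord j; have := ltn_ord i; lia.
  by move/forallP: (nd i) => /(_ (Ordinal jn)); rewrite dec_rows.
apply/forallP => j; have jn : (j < n)%N by have := ltn_ord j; have := ltn_ord i; lia.
have jn1 : (j.+1 < n)%N by have := ltn_ord j; have := ltn_ord i; lia.
have ji := ltn_ord j.
have im : (i.-1 < n)%N by have := ltn_ord i; lia.
rewrite -!ent_rows -!dec_rows prev_rows; [|lia|by apply: ltnW].
move/forallP: (gt (Ordinal im)) => /(_ (Ordinal jn)) /implyP /=.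
have -> : (j <= i.-1)%N && (i.-1.+1 < n)%N by have := ltn_ord i; lia.
have -> : i.-1.+1 = i by lia.
move=> /(_ isT) /andP [g1 g2].
move/forallP: (arr i) => /(_ (Ordinal jn)) /implyP /= /(_ (ltnW ji)) /andP [/implyP a1 _].
move/forallP: (arr i) => /(_ (Ordinal jn1)) /implyP /= /(_ ji) /andP [_ /implyP a2].
have i0 : (0 < i)%N by lia.
rewrite i0 ji /= in a1 a2.
apply/and4P; split => //.
  by apply/implyP => h; apply: a1; rewrite eq_sym.
by apply/implyP => h; rewrite [X in X && _]eq_sym eq_sym; rewrite eq_sym in h; apply: a2.
Qed.

(** [rowspecial] counts a special triangle at its lower row and [nspecial] at its top entry. The
    shift by one row is harmless since row 0 has nothing above it and the last row nothing below. *)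
Lemma rowspecial_nspecial :
  (\sum_(i < n) rowspecial i (prev i) (f i).1 (f i).2)%N = nspecial P.
Proof.
pose sp (i j : nat) : nat :=
  [&& (j < i)%N, ent P i.-1 j == ent P i j, ent P i.-1 j == ent P i j.+1,
      dec_ne (dec P i j) & dec_nw (dec P i j.+1)].
have -> : (\sum_(i < n) rowspecial i (prev i) (f i).1 (f i).2)%N =
    (\sum_(i < n) \sum_(j < n) sp i j)%N.
  apply: eq_bigr => i _; rewrite /rowspecial.
  rewrite (big_ord_widen n (fun j : nat => (psispecial (natfun ord0 (f i).1 j)
    (natfun ord0 (f i).1 j.+1) (dec_ne (natfun ord0 (f i).2 j))
    (dec_nw (natfun ord0 (f i).2 j.+1)) (natfun ord0 (prev i) j)) : nat)); last exact: ltnW.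
  rewrite big_mkcond; apply: eq_bigr => j _; rewrite /sp; case: ltnP => //= ji.
  by rewrite -!ent_rows -!dec_rows prev_rows //; [lia | apply: ltnW].
pose sp' (i j : nat) : nat := [&& (j <= i)%N, (i.+1 < n)%N, ent P i j == ent P i.+1 j,
  ent P i j == ent P i.+1 j.+1, dec_ne (dec P i.+1 j) & dec_nw (dec P i.+1 j.+1)].
rewrite /nspecial -[RHS]/(\sum_(i < n) \sum_(j < n) sp' i j)%N.
pose g (i : nat) : nat := (\sum_(j < n) sp i j)%N.
pose g' (i : nat) : nat := (\sum_(j < n) sp' i j)%N.
rewrite -[LHS]/(\sum_(i < n) g i)%N -[RHS]/(\sum_(i < n) g' i)%N.
have g0 : g 0%N = 0%N by rewrite /g big1.
have gS i : (i.+1 < n)%N -> g i.+1 = g' i.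
  by move=> i1; apply: eq_bigr => j _; rewrite /sp /sp' i1 ltnS.
have g'n i : (n <= i.+1)%N -> g' i = 0%N.
  by move=> ni; rewrite /g' big1 // => j _; rewrite /sp' ltnNge ni andbF.
move: gS g'n; clearbody g g'; clear -g0; case: n => [|n'] gS g'n; first by rewrite !big_ord0.
rewrite big_ord_recl [RHS]big_ord_recr /= g0 g'n // addn0 add0n.
by apply: eq_bigr => i _; rewrite gS // ltnS.
Qed.

End FixRows.

Definition strict_row (k : entries) : bool :=
  [forall j : 'I_n, (j.+1 < n)%N ==> (natfun ord0 k j < natfun ord0 k j.+1)%N].

Lemma bottom_strict_rows (f : {ffun 'I_n -> row}) (i : 'I_n) : n = i.+1 :> nat ->
  bottom_strict (pat_of_rows f) = strict_row (f i).1.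
Proof.
move=> ni; rewrite /bottom_strict /strict_row; apply: eq_forallb => j.
have -> : n.-1 = i by exact: (congr1 predn ni).
by rewrite !ent_rows.
Qed.

Theorem sum_patterns : (0 < n)%N ->
  (\sum_(P : Pat n m | [&& arrowed_GT P, no_double P & bottom_strict P]) sgn P)%:~R =
  \sum_(k : entries | strict_row k) agtp (fun=> 1 : K) n k.
Proof.
move=> n0; have nE : n = n.-1.+1 by rewrite prednK.
have n1 : (n.-1 < n)%N by lia.
rewrite rmorph_sum /= big_mkcond (reindex pat_of_rows) /=; last first.
  by apply: onW_bij; exact: pat_of_rows_bij.
pose chi (o : option row) : K := if o is Some u then (strict_row u.1)%:R else 0.
transitivity (\sum_o chi o * chain transfer n o).
  rewrite -sum_chain; apply: eq_bigr => f _.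
  have -> : chi (before f n) = (bottom_strict (pat_of_rows f))%:R.
    rewrite (@bottom_strict_rows f (Ordinal n1)) //=.
    have -> : before f n = Some (f (Ordinal n1)).
      transitivity (before f n.-1.+1); first by rewrite prednK.
      by rewrite /= (insubT (fun i => i < n)%N n1).
    by [].
  rewrite (eq_bigr (fun i : 'I_n => (-1) ^+ rowspecial i
    (if before f i is Some u then u.1 else [ffun=> ord0]) (f i).1 (f i).2 *
    (rowok i (if before f i is Some u then u.1 else [ffun=> ord0]) (f i).1 (f i).2)%:R)); last first.
    by move=> i _; rewrite /transfer rowwt1.
  rewrite big_split /= prodrXr rowspecial_nspecial -natr_forall rowsok.
  rewrite -mulrA -natrM mulnb -andbA; case: ifP => _; rewrite ?mulr1 ?mulr0 //.
  by rewrite /sgn rmorphXn rmorphN1.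
rewrite sum_option /chi mul0r add0r [RHS]big_mkcond /=.
transitivity (\sum_(k : entries) \sum_(d : decs) (strict_row k)%:R * chain transfer n (Some (k, d))).
  by rewrite pair_bigA; apply: eq_bigr => -[].
apply: eq_bigr => k _; rewrite -mulr_sumr.
case: ifP => _; rewrite ?mul0r // mul1r.
by move: (chain_agtp n.-1 k); rewrite -nE.
Qed.

End Patterns.

(** * Summation over strictly increasing bottom rows *)

Section TotalGeneratingFunction.
Variables (K : numFieldType) (n m : nat).
Local Notation entries := {ffun 'I_n -> 'I_m.+1}.

Definition above (o : option 'I_m.+1) (t : nat) : bool :=
  if o is Some u then (u < t)%N else true.

Lemma chain_strictsum (y : nat -> K) r (t : 'I_m.+1) :
  chain (fun i o t => (above o t)%:R * y i ^+ t)
    r.+1 (Some t) = y r ^+ t * strictsum y r t.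
Proof.
elim: r t => [|r IHr] t; rewrite [LHS]/= sum_option.
  by rewrite [X in _ + X]big1 => [|u _]; rewrite /= ?mulr0 // mulr1 mulr1 addr0 mul1r.
rewrite mulr0 add0r [strictsum _ _ _]/= mulr_sumr.
rewrite (big_ord_widen m.+1 (fun v => y r.+1 ^+ t * (y r ^+ v * strictsum y r v))); last exact: ltnW.
rewrite [RHS]big_mkcond; apply: eq_bigr => u _; rewrite -[X in _ * X]/(chain _ r.+1 (Some u)) IHr.
by rewrite [above _ _]/=; case: (u < t)%N; rewrite ?mul0r ?mul1r.
Qed.

Lemma sum_strict_row (y : nat -> K) :
  \sum_(k : entries | strict_row k) \prod_(i < n) y i ^+ natfun ord0 k i = strictsum y n m.+1.
Proof.
pose phi (i : nat) (o : option 'I_m.+1) (t : 'I_m.+1) : K :=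
  (above o t)%:R * y i ^+ t.
transitivity (\sum_o 1 * chain phi n o); last first.
  under eq_bigr do rewrite mul1r.
  rewrite sum_option; case: n => [|r].
    by rewrite big1 /= ?addr0 // => t _.
  by rewrite add0r; apply: eq_bigr => t _; rewrite chain_strictsum.
rewrite -sum_chain big_mkcond; apply: eq_bigr => k _; rewrite mulr1 /phi big_split /=.
have -> : \prod_(i < n) (above (before k i) (k i))%:R =
    (strict_row k)%:R :> K.
  rewrite -natr_forall; congr (nat_of_bool _)%:R; apply/forallP/forallP => h j; last first.
    case: j => -[|j] // jn /=; have jn' : (j < n)%N by apply: ltnW.
    rewrite (insubT (fun i => i < n)%N jn') /=; have /implyP /(_ jn) := h (Ordinal jn').
    by rewrite natfunE -[j.+1]/(val (Ordinal jn)) natfunE.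
  apply/implyP => jn; have := h (Ordinal jn).
  by rewrite /= valK /= natfunE -[j.+1]/(val (Ordinal jn)) natfunE.
by case: ifP => _; rewrite ?mul1r ?mul0r //; apply: eq_bigr => i _; rewrite natfunE.
Qed.

Lemma sum_Wsum (x : 'I_n -> K) :
  \sum_(k : entries | strict_row k) Wsum (fun i : 'I_n => natfun ord0 k i) x =
  littlewoodsum m.+1 x.
Proof.
rewrite /Wsum exchange_big; apply: eq_bigr => s _; rewrite -mulr_sumr -mulr_sumr.
rewrite -sum_strict_row; congr (_ * (_ * _)); apply: eq_bigr => k _; apply: eq_bigr => i _.
by rewrite !natfunE.
Qed.

Theorem total_generating_function (x : nat -> K) :
  (forall i, (i < n)%N -> regular (x i)) ->
  (forall i j, (i < j)%N -> (j < n)%N -> x i != x j) ->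
  (\sum_(k : entries | strict_row k) agtp x n k) * vdm x n *
    (\prod_(i < n) (1 - x i) * pairprod (fun p q : 'I_n => 1 - x p * x q)) =
  \prod_(i < n) (1 + x i + (x i)^-1) *
    lwdet (fun i : 'I_n => x i ^+ (m.+1 + n.*2) / x i ^+ 2) (fun i : 'I_n => x i).
Proof.
move=> xreg xD; rewrite mulr_suml.
rewrite (eq_bigr (fun k : entries => \prod_(i < n) (1 + x i + (x i)^-1) *
    Wsum (fun i : 'I_n => natfun ord0 k i) (fun i : 'I_n => x i))) => [|k sk].
  by rewrite -mulr_sumr sum_Wsum -mulrA bounded_littlewood // => i; apply: xreg.
apply: operator_formula => //.
- by move=> i ile; case/and3P: (xreg i ile).
- by apply/forallP => j; apply/implyP; rewrite leqNgt ltn_ord.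
- move=> j jn; have jn' : (j < n)%N by apply: ltnW.
  by move/forallP: sk => /(_ (Ordinal jn')) /implyP /(_ jn) /ltnW.
Qed.

End TotalGeneratingFunction.

(** * The determinant as a polynomial in its parameter *)

Section PolynomialIdentity.
Variable K : numFieldType.

Lemma poly_eq_roots (p q : {poly K}) (f : nat -> K) : injective f ->
  (forall k, p.[f k] = q.[f k]) -> p = q.
Proof.
move=> finj pq; apply/eqP; rewrite -subr_eq0; apply/eqP.
apply: (@roots_geq_poly_eq0 _ _ [seq f k | k <- iota 0 (size (p - q)).+1]).
- by apply/allP => _ /mapP [k _ ->]; rewrite /root !hornerE pq subrr.
- by rewrite map_inj_uniq ?iota_uniq.
- by rewrite size_map size_iota.
Qed.

Lemma poly_eq_nat (p q : {poly K}) A0 :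
  (forall A, (A0 <= A)%N -> p.[A%:R] = q.[A%:R]) -> p = q.
Proof.
move=> pq; apply: (@poly_eq_roots _ _ (fun k => (A0 + k)%:R)).
  by move=> i j /eqP; rewrite eqr_nat eqn_add2l => /eqP.
by move=> k; apply: pq; rewrite leq_addr.
Qed.

End PolynomialIdentity.

Section MonicFamilies.
Variable R : comNzRingType.

Lemma det_unitriangular n (p : 'I_n -> {poly R}) :
  (forall a, p a \is monic) -> (forall a : 'I_n, size (p a) = a.+1) ->
  \det (\matrix_(j < n, a < n) (p a)`_j) = 1.
Proof.
move=> pm sp; rewrite -det_tr det_trig; last first.
  by apply/is_trig_mxP => a j aj; rewrite !mxE nth_default // sp.
rewrite big1 // => a _; rewrite !mxE; have := monicP (pm a).
by rewrite lead_coefE sp.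
Qed.

Lemma det_monic_horner n (p : 'I_n -> {poly R}) (x : 'I_n -> R) :
  (forall a, p a \is monic) -> (forall a : 'I_n, size (p a) = a.+1) ->
  \det (\matrix_(k < n, a < n) (p a).[x k]) = pairprod (fun i j => x j - x i).
Proof.
move=> pm sp; have -> : \matrix_(k < n, a < n) (p a).[x k] =
    (Vandermonde n (\row_k x k))^T *m \matrix_(j < n, a < n) (p a)`_j.
  apply/matrixP => k a; rewrite !mxE (@horner_coef_wide _ n) ?sp //.
  by apply: eq_bigr => j _; rewrite !mxE mulrC.
rewrite det_mulmx det_unitriangular // mulr1 det_tr det_Vandermonde.
by apply: eq_bigr => i _; apply: eq_bigr => j _; rewrite !mxE.
Qed.

Lemma size_prod_coef (I : Type) (s : seq I) (f : I -> {poly R}) (r : I -> nat) :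
  (forall i, (size (f i) <= (r i).+1)%N) ->
  (size (\prod_(i <- s) f i)%R <= (\sum_(i <- s) r i).+1)%N /\
  (\prod_(i <- s) f i)`_(\sum_(i <- s) r i)%N = \prod_(i <- s) (f i)`_(r i).
Proof.
move=> sf; elim: s => [|i s [IH1 IH2]]; first by rewrite !big_nil size_poly1 coef1.
rewrite !big_cons; set P := \prod_(j <- s) f j; set S := (\sum_(j <- s) r j)%N in IH1 IH2 *.
split.
  apply: leq_trans (size_polyMleq _ _) _.
  by have := sf i; move: IH1; rewrite -/P; lia.
rewrite coefM (bigD1 (inord (r i))) //= inordK ?ltnS ?leq_addr // addKn -IH2 big1 ?addr0 //.
move=> j; rewrite -val_eqE /= inordK ?ltnS ?leq_addr // => jr.
have [lt|] := ltnP (r i) j; first by rewrite nth_default ?mul0r // (leq_trans (sf i)).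
rewrite leq_eqVlt (negPf jr) /= => lt; rewrite [X in _ * X]nth_default ?mulr0 //.
by apply: leq_trans IH1 _; lia.
Qed.

(** Every product in the determinant takes one entry per row, so bounds that are uniform along rows
    add up. The coefficients are taken at these bounds, and may be zero. *)
Lemma det_coef_rows n (M : 'M[{poly R}]_n) (r : 'I_n -> nat) :
  (forall k a, (size (M k a) <= (r k).+1)%N) ->
  (size (\det M) <= (\sum_k r k).+1)%N /\
  (\det M)`_(\sum_k r k)%N = \det (\matrix_(k, a) (M k a)`_(r k)).
Proof.
move=> sM; pose P (s : 'S_n) := \prod_k M k (s k).
have sP s := size_prod_coef (index_enum 'I_n) (f := fun k => M k (s k)) (r := r) (fun k => sM k (s k)).
have sgE (s : 'S_n) : (-1) ^+ s * P s = ((-1) ^+ s)%:P * P s by rewrite polyC_exp polyCN.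
split.
  rewrite /determinant; apply: (leq_trans (size_sum _ _ _)); apply/bigmax_leqP => s _.
  rewrite -/(P s) sgE mul_polyC; apply: leq_trans (size_scale_leq _ _) _.
  by case: (sP s).
rewrite /determinant coef_sum; apply: eq_bigr => s _.
rewrite -/(P s) sgE coefCM; congr (_ * _); case: (sP s) => _ ->.
by apply: eq_bigr => k _; rewrite mxE.
Qed.

End MonicFamilies.

Section OddCoefficientDet.
Variable K : numFieldType.

(* The polynomial in T taking the value 'C(A - s, l) at T = A, for A >= s. *)
Definition binpoly (s l : nat) : {poly K} :=
  (l`!%:R)^-1 *: \prod_(i < l) ('X - (s + i)%:R%:P).

Lemma horner_ffact s l A : (s <= A)%N ->
  (\prod_(i < l) ('X - (s + i)%:R%:P)).[A%:R] = ((A - s) ^_ l)%:R :> K.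
Proof.
move=> sA; rewrite horner_prod; elim: l => [|l IHl]; first by rewrite big_ord0.
rewrite big_ord_recr /= IHl ffactnSr natrM !hornerE.
have [le|lt] := leqP l (A - s); last by rewrite ffact_small // !mul0r.
by rewrite !natrB //; ring.
Qed.

Lemma natr_fact_neq0 l : l`!%:R != 0 :> K.
Proof. by rewrite pnatr_eq0 -lt0n fact_gt0. Qed.

Lemma horner_binpoly s l A : (s <= A)%N -> (binpoly s l).[A%:R] = 'C(A - s, l)%:R.
Proof.
move=> sA; rewrite hornerZ horner_ffact //; apply: (canLR (mulKf (natr_fact_neq0 l))).
by rewrite -natrM mulnC bin_ffact.
Qed.

Lemma size_binpoly s l : size (binpoly s l) = l.+1.
Proof.
have f0 : (l`!%:R)^-1 != 0 :> K by rewrite invr_eq0 pnatr_eq0 -lt0n fact_gt0.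
rewrite size_scale // -(big_mkord xpredT (fun i => 'X - (s + i)%:R%:P)).
by rewrite size_prod_XsubC size_iota subn0.
Qed.

Lemma lead_binpoly s l : (binpoly s l)`_l = (l`!%:R)^-1.
Proof.
have := lead_coefE (binpoly s l); rewrite size_binpoly /= => <-.
by rewrite /binpoly lead_coefZ lead_coef_prod_XsubC mulr1.
Qed.

Lemma coef_exprD1X n i : ((1 + 'X : {poly K}) ^+ n)`_i = 'C(n, i)%:R.
Proof.
have -> : (1 + 'X : {poly K}) ^+ n = \poly_(i < n.+1) 'C(n, i)%:R.
  rewrite exprDn poly_def; apply: eq_bigr => j _.
  by rewrite expr1n mul1r -scaler_nat.
by rewrite coef_poly; case: ltnP => // ni; rewrite bin_small.
Qed.

(** The coefficient of w^(2k+1) in b(w) (1 + w)^(T - s), as a polynomial in T. *)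
Definition oddcoef (b : {poly K}) (s k : nat) : {poly K} :=
  \sum_(i < k.*2.+2) b`_i *: binpoly s (k.*2.+1 - i).

Lemma horner_oddcoef b s k A : (s <= A)%N ->
  (oddcoef b s k).[A%:R] = (b * (1 + 'X) ^+ (A - s))`_(k.*2.+1).
Proof.
move=> sA; rewrite /oddcoef horner_sum coefM; apply: eq_bigr => i _.
by rewrite hornerZ horner_binpoly // coef_exprD1X.
Qed.

Variable n : nat.

Definition paramdet : 'M[{poly K}]_n :=
  \matrix_(k < n, j < n) oddcoef (2 ^+ j *: (1 - 'X) ^+ j) j.*2 k.

(* With [u = 2 (1 - w) / (1 + w)^2], the columns of [paramdet] are the odd
   coefficients in w of (1 + w)^A u^j; a change of basis in u replaces u^a by
   u^b (u + g)^(a - b). *)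
Definition basispoly (g : K) (a b : nat) : {poly K} := 'X^b * ('X + g%:P) ^+ (a - b).

(** [basispoly g a b] at u = 2 (1 - w) / (1 + w)^2, cleared of its denominator (1 + w)^(2a). *)
Definition homogpoly (g : K) (a b : nat) : {poly K} :=
  (2 *: (1 - 'X)) ^+ b * (2 *: (1 - 'X) + g *: (1 + 'X) ^+ 2) ^+ (a - b).

Lemma basispoly_monic g a b : basispoly g a b \is monic.
Proof.
rewrite monicMl ?monicXn // monic_exp // -[g%:P]opprK -polyCN; exact: monicXsubC.
Qed.

Lemma size_basispoly g a b : (b <= a)%N -> size (basispoly g a b) = a.+1.
Proof.
move=> ba; rewrite /basispoly size_monicM ?monicXn ?expf_neq0 //; last first.
  by rewrite -size_poly_eq0 size_XaddC.
rewrite size_polyXn -[g%:P]opprK -polyCN size_exp_XsubC; lia.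
Qed.

Lemma basis_homog g a b A : (b <= a)%N -> (a.*2 <= A)%N -> (n.*2 <= A)%N -> (a < n)%N ->
  \sum_(j < n) (basispoly g a b)`_j *: (2 ^+ j *: (1 - 'X) ^+ j * (1 + 'X) ^+ (A - j.*2)) =
  homogpoly g a b * (1 + 'X) ^+ (A - a.*2) :> {poly K}.
Proof.
(* Both sides are compared at natural numbers w, where 1 + w is invertible and u is defined. *)
move=> ba aA nA an; apply: (@poly_eq_nat _ _ _ 0) => w _.
have w1 : 1 + w%:R != 0 :> K by rewrite -mulrS pnatr_eq0.
set y : K := w%:R in w1 *; pose u := 2 * (1 - y) / (1 + y) ^+ 2.
have y2 : (1 + y) ^+ 2 != 0 by rewrite expf_neq0.
transitivity ((1 + y) ^+ A * (basispoly g a b).[u]).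
  rewrite [in RHS](@horner_coef_wide _ n) ?size_basispoly // mulr_sumr horner_sum.
  apply: eq_bigr => j _; rewrite !hornerE /u.
  have jA : (j.*2 <= A)%N by apply: leq_trans nA; rewrite leq_double ltnW.
  rewrite -{2}(subnK jA) exprD expr_div_n exprMn -mul2n exprM.
rewrite /=.
  by field; rewrite ?expf_neq0 ?w1.
rewrite /basispoly /homogpoly !hornerE.
have -> : u + g = (2 * (1 - y) + g * (1 + y) ^+ 2) / (1 + y) ^+ 2 by rewrite /u; field.
rewrite /u -{1}(subnK aA) exprD -mul2n exprM -{2}(subnK ba) exprD !expr_div_n.
rewrite /= -[g * (1 + y) * (1 + y)]mulrA -expr2.
by field; rewrite ?expf_neq0 ?w1.
Qed.

Lemma basis_oddcoef g a b k : (b <= a)%N -> (a < n)%N ->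
  \sum_(j < n) (basispoly g a b)`_j *: oddcoef (2 ^+ j *: (1 - 'X) ^+ j) j.*2 k =
  oddcoef (homogpoly g a b) a.*2 k.
Proof.
move=> ba an; apply: (@poly_eq_nat _ _ _ n.*2) => A nA.
have dA j : (j < n)%N -> (j.*2 <= A)%N by move=> jn; apply: leq_trans nA; rewrite leq_double ltnW.
rewrite horner_oddcoef ?dA // -(basis_homog _ ba (dA _ an) nA an) coef_sum horner_sum.
by apply: eq_bigr => j _; rewrite hornerZ horner_oddcoef ?dA // [RHS]coefZ.
Qed.

(** Whatever exponent [b a] is chosen in each column, the basis polynomials are monic of degree [a],
    so the change of basis has determinant 1. *)
Lemma det_paramdet g (b : 'I_n -> nat) : (forall a : 'I_n, (b a <= a)%N) ->
  \det paramdet = \det (\matrix_(k < n, a < n) oddcoef (homogpoly g a (b a)) a.*2 k).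
Proof.
move=> ba; have pm (a : 'I_n) : basispoly g a (b a) \is monic by apply: basispoly_monic.
have sp (a : 'I_n) : size (basispoly g a (b a)) = a.+1 by apply: size_basispoly.
have := det_unitriangular pm sp; set U := \matrix_(_, _) _ => detU.
rewrite -[LHS]mulr1 -polyC1 -detU -det_map_mx -det_mulmx; congr (\det _).
apply/matrixP => k a; rewrite !mxE -basis_oddcoef //.
by apply: eq_bigr => j _; rewrite !mxE mulrC mul_polyC.
Qed.

(* Since [u^b (u + 1)^(a - b)] only contributes even coefficients when
   [A = 2 a + b], every [A] has at least as many vanishing columns as there are
   [a] with [2 a <= A <= 3 a]. *)
Definition admissible (al a : nat) : bool := (a.*2 <= al <= a + a.*2)%N.

Lemma oddcoef_root al a k : admissible al a ->
  root (oddcoef (homogpoly 1 a (al - a.*2)) a.*2 k) al%:R.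
Proof.
case/andP=> a2 a3; rewrite /root horner_oddcoef //.
(* The choice g = 1 gives 2 (1 - w) + (1 + w)^2 = 3 + w^2, and the remaining powers of 1 + w pair
   with those of 1 - w, so only w^2 occurs. *)
have -> : homogpoly 1 a (al - a.*2) * (1 + 'X) ^+ (al - a.*2) =
    ((2%:P * (1%:P - 'X)) ^+ (al - a.*2) * (3%:P + 'X) ^+ (a - (al - a.*2))) \Po 'X^2 :> {poly K}.
  rewrite comp_polyM !rmorphXn /= comp_polyM comp_polyB comp_polyD !comp_polyC comp_polyX.
  rewrite /homogpoly scale1r mulrAC -exprMn; congr (_ ^+ _ * _ ^+ _).
    by rewrite -!mul_polyC; ring.
  by rewrite -!mul_polyC; ring.
by rewrite coef_comp_poly_Xn // dvdn2 /= odd_double.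
Qed.

Lemma dvdp_det_columns (M : 'M[{poly K}]_n) (P : pred 'I_n) (c : K) :
  (forall k a, P a -> root (M k a) c) -> ('X - c%:P) ^+ #|P| %| \det M.
Proof.
move=> rM; pose d (a : 'I_n) : {poly K} := if P a then 'X - c%:P else 1.
have -> : M = (\matrix_(k, a) (M k a %/ d a)) *m diag_mx (\row_a d a).
  rewrite mul_mx_diag; apply/matrixP => k a; rewrite !mxE /d; case: ifP => Pa.
    by rewrite divpK // dvdp_XsubCl; apply: rM.
  by rewrite divp1 mulr1.
rewrite det_mulmx det_diag dvdp_mull //.
under eq_bigr do rewrite mxE /d.
by rewrite -big_mkcond prodr_const.
Qed.

Definition zeropoly : {poly K} :=
  \prod_(a < n) \prod_(al < 3 * n | admissible al a) ('X - al%:R%:P).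

(** A basis adapted to one value [al] does not show the zeros at other values. Hence each power of
    ['X - al] is shown to divide in its own basis, and powers for distinct [al] are coprime. *)
Lemma zeropoly_dvd : zeropoly %| \det paramdet.
Proof.
pose f (al : nat) : {poly K} := ('X - al%:R%:P) ^+ #|[pred a : 'I_n | admissible al a]|.
have fdvd al : f al %| \det paramdet.
  pose b (a : 'I_n) := if admissible al a then (al - a.*2)%N else 0%N.
  rewrite (@det_paramdet 1 b) => [|a]; last by rewrite /b /admissible; case: ifP => //; lia.
  apply: dvdp_det_columns => k a /= ad.
  by rewrite mxE /b ad; apply: oddcoef_root.
have -> : zeropoly = \prod_(al < 3 * n) f al.
  rewrite /zeropoly; under eq_bigr do rewrite big_mkcond.
  rewrite exchange_big; apply: eq_bigr => al _ /=.
  by rewrite -big_mkcond prodr_const.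
elim: (3 * n)%N => [|N IHN]; first by rewrite big_ord0 dvd1p.
rewrite big_ord_recr /= Gauss_dvdp ?IHN ?fdvd //.
rewrite coprimep_expr // coprimep_XsubC /root horner_prod.
apply/prodf_neq0 => i _; rewrite horner_exp expf_neq0 // !hornerE subr_eq0 eqr_nat.
by rewrite neq_ltn ltn_ord orbT.
Qed.

Lemma zeropolyE : zeropoly =
  \prod_(a < n) \prod_(b < a.+1) ('X - (b + a.*2)%:R%:P).
Proof.
apply: eq_bigr => a _; have an := ltn_ord a.
rewrite (big_ord_interval _ (lo := a.*2) (hi := (a.+1 + a.*2)%N) (fun al => 'X - al%:R%:P)); try by lia.
by rewrite -{1}[a.*2]add0n big_addn addnK big_mkord.
Qed.

Lemma size_zeropoly : size zeropoly = (\sum_(a < n) a.+1).+1%N.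
Proof.
rewrite zeropolyE size_prod => [|a _]; last by apply/prodf_neq0 => b _; rewrite polyXsubC_eq0.
rewrite (eq_bigr (fun a : 'I_n => (a.+1 + 1)%N)) => [|a _]; last first.
  rewrite -(big_mkord xpredT (fun b => 'X - (b + a.*2)%:R%:P)) size_prod_XsubC.
  by rewrite size_iota subn0 addn1.
by rewrite big_split sum1_card /= -addSn addnK.
Qed.

Lemma zeropoly_monic : zeropoly \is monic.
Proof. by rewrite rpred_prod // => a _; rewrite rpred_prod // => b _; rewrite monicXsubC. Qed.

(** (-6)^a is the lowest coefficient of (-2 w (3 + w))^a, the numerator of (u - 2)^a. The rest is
    1/(2k + 1 - a)!, which the falling factorial extends by zero to a > 2k + 1. *)
Definition leadmx : 'M[K]_n :=
  \matrix_(k < n, a < n) ((-6) ^+ a * (k.*2.+1 ^_ a)%:R / (k.*2.+1)`!%:R).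

(* For [g = -2] the polynomial [(u - 2)^a] vanishes to order [a] at [w = 0], which
   lowers the degree in the parameter. *)
Lemma shifted_oddcoef (a k : nat) (M := 'X^a * oddcoef (homogpoly (-2) a 0) a.*2 k) :
  (size M <= k.*2.+2)%N /\
  M`_(k.*2.+1) = (-6) ^+ a * (k.*2.+1 ^_ a)%:R / (k.*2.+1)`!%:R.
Proof.
have hE : homogpoly (-2) a 0 = 'X^a * ((-2) *: (3%:P + 'X)) ^+ a.
  rewrite /homogpoly expr0 mul1r subn0 -exprMn; congr (_ ^+ _).
  by rewrite -!mul_polyC; ring.
have h_lt i : (i < a)%N -> (homogpoly (-2) a 0)`_i = 0 by move=> ia; rewrite hE coefXnM ia.
have h_a : (homogpoly (-2) a 0)`_a = (-6) ^+ a.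
  rewrite hE coefXnM ltnn subnn -horner_coef0 horner_exp !hornerE.
  by congr (_ ^+ _); ring.
have ME : M = \sum_(i < k.*2.+2) (homogpoly (-2) a 0)`_i *: ('X^a * binpoly a.*2 (k.*2.+1 - i)).
  by rewrite /M mulr_sumr; apply: eq_bigr => i _; rewrite scalerAr.
have sX l : size ('X^a * binpoly a.*2 l) = (a + l).+1.
  by rewrite mulrC size_mulXn ?size_binpoly ?addnS // -size_poly_eq0 size_binpoly.
split.
  rewrite ME; apply: (leq_trans (size_sum _ _ _)); apply/bigmax_leqP => i _.
  have [ia|ai] := ltnP i a; first by rewrite h_lt // scale0r size_poly0.
  by apply: leq_trans (size_scale_leq _ _) _; rewrite sX; have := ltn_ord i; lia.
rewrite ME coef_sum; have [ak|ka] := ltnP a k.*2.+2; last first.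
  rewrite ffact_small // mulr0 mul0r big1 // => i _.
  by rewrite h_lt ?scale0r ?coef0 // (leq_trans (ltn_ord i)).
rewrite (bigD1 (Ordinal ak)) //= big1 ?addr0 => [|i]; last first.
  rewrite -val_eqE /= => ia; have [lt|ge] := ltnP i a; first by rewrite h_lt // scale0r coef0.
  by rewrite coefZ [X in _ * X]nth_default ?mulr0 // sX; have := ltn_ord i; lia.
rewrite coefZ h_a coefXnM ltnNge -ltnS ak /= lead_binpoly -mulrA; congr (_ * _).
have := ffact_fact (ak : (a <= k.*2.+1)%N) => <-.
rewrite natrM invfM mulrA mulfV ?mul1r //.
by rewrite pnatr_eq0 -lt0n ffact_gt0.
Qed.

Theorem paramdet_factor : \det paramdet = \det leadmx *: zeropoly.
Proof.
pose M := \matrix_(k < n, a < n) oddcoef (homogpoly (-2) a 0) a.*2 k.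
(* The entry in row k and column a of [M] has degree at most 2k + 1 - a. The factor ['X^a] makes the
   bound uniform along the row, as [det_coef_rows] requires. *)
pose M' := \matrix_(k < n, a < n) ('X^a * oddcoef (homogpoly (-2) a 0) a.*2 k).
have detM : \det paramdet = \det M by rewrite (@det_paramdet (-2) (fun=> 0%N)).
have detM' : \det M' = \det M * 'X^(\sum_(a < n) a).
  have -> : M' = M *m diag_mx (\row_a 'X^a).
    by rewrite mul_mx_diag; apply/matrixP => k a; rewrite !mxE mulrC.
  rewrite det_mulmx det_diag; congr (_ * _); rewrite -prodrXr.
  by apply: eq_bigr => a _; rewrite mxE.
have sM'0 (k a : 'I_n) : (size (M' k a) <= k.*2.+2)%N.
  by rewrite mxE; case: (shifted_oddcoef a k).
have [sM' cM'] := det_coef_rows sM'0.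
have LE : \det (\matrix_(k, a) (M' k a)`_(k.*2.+1)) = \det leadmx.
  by congr (\det _); apply/matrixP => k a; rewrite !mxE; case: (shifted_oddcoef a k).
(* After removal of the powers of ['X], the degree bound equals the degree of [zeropoly], so the
   quotient is a constant. *)
have sumE : (\sum_(k < n) k.*2.+1 = \sum_(a < n) a.+1 + \sum_(a < n) a)%N.
  by rewrite -big_split /=; apply: eq_bigr => a _; rewrite -addnn.
have cM : (\det M)`_(\sum_(a < n) a.+1) = \det leadmx.
  by rewrite -LE -cM' detM' coefMXn sumE ltnNge leq_addl /= addnK.
have sM : (size (\det M) <= (\sum_(a < n) a.+1).+1)%N.
  have [-> | M0] := eqVneq (\det M) 0; first by rewrite size_poly0.
  by move: sM'; rewrite detM' size_mulXn // sumE addnC -addSn leq_add2r.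
have /dvdpP [q qE] := zeropoly_dvd; rewrite detM in qE.
have zm := zeropoly_monic; have z0 : zeropoly != 0 by apply: monic_neq0.
have [q0 | q0] := eqVneq q 0.
  by rewrite detM -cM qE q0 mul0r coef0 scale0r.
have /size_poly1P [c c0 qc] : size q == 1%N.
  rewrite eqn_leq size_poly_gt0 q0 andbT.
  move: sM; rewrite qE size_mul // size_zeropoly.
  by move: (size q) (\sum_(a < n) a.+1)%N => u v; lia.
rewrite detM qE qc mul_polyC; congr (_ *: _).
rewrite -cM qE qc coefCM; have := monicP zm; rewrite lead_coefE size_zeropoly /= => ->.
by rewrite mulr1.
Qed.

(** Falling factorials are monic polynomials in 2k + 1, so apart from row and column factors this is
    a Vandermonde determinant in the odd numbers. *)
Lemma det_leadmx : \det leadmx =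
  \prod_(a < n) ((-6) ^+ a * 2 ^+ a * a`!%:R / (a.*2.+1)`!%:R).
Proof.
pose p (a : 'I_n) : {poly K} := \prod_(i < a) ('X - i%:R%:P).
pose x (k : 'I_n) : K := (k.*2.+1)%:R.
have pm a : p a \is monic by rewrite rpred_prod // => i _; rewrite monicXsubC.
have sp (a : 'I_n) : size (p a) = a.+1.
  by rewrite /p -(big_mkord xpredT (fun i => 'X - i%:R%:P)) size_prod_XsubC size_iota subn0.
have -> : leadmx = diag_mx (\row_k (k.*2.+1)`!%:R^-1) *m
    (\matrix_(k < n, a < n) (p a).[x k]) *m diag_mx (\row_a (-6) ^+ a).
  rewrite mul_mx_diag mul_diag_mx; apply/matrixP => k a; rewrite !mxE.
  have := @horner_ffact 0 a (k.*2.+1) (leq0n _); rewrite subn0 => <-.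
  have perm3 (u v w : K) : u * v * w = w * v * u by ring.
  exact: perm3.
rewrite !det_mulmx !det_diag (det_monic_horner x pm sp) /x.
rewrite (pairprod_nat _ (fun i j => (j.*2.+1)%:R - (i.*2.+1)%:R)).
rewrite -!big_split; apply: eq_bigr => a _; rewrite !mxE.
have -> : \prod_(i < a) ((a.*2.+1)%:R - (i.*2.+1)%:R : K) = 2 ^+ a * a`!%:R.
  rewrite (eq_bigr (fun i : 'I_a => 2 * (a - i)%:R)) => [|i _].
    rewrite big_split /= prodr_const card_ord; congr (_ * _).
    by rewrite -natr_prod -ffact_prod ffactnn.
  rewrite natrB ?(ltnW (ltn_ord i)) // -[a.*2.+1]addn1 -[i.*2.+1]addn1 !natrD -!muln2 !natrM.
  by ring.
by rewrite /= ?mxE; ring.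
Qed.

End OddCoefficientDet.

Section PairProductScale.
Variable R : comNzRingType.

Lemma pairprodM n (f g : 'I_n -> 'I_n -> R) :
  pairprod (fun p q => f p q * g p q) = pairprod f * pairprod g.
Proof. by rewrite /pairprod -big_split; apply: eq_bigr => p _; rewrite big_split. Qed.

Lemma pairprod_const n (c : R) : pairprod (fun _ _ : 'I_n => c) = c ^+ (\sum_(q < n) q).
Proof.
rewrite (pairprod_nat n (fun _ _ => c)) -prodrXr; apply: eq_bigr => q _.
by rewrite prodr_const card_ord.
Qed.

Lemma eq_pairprod n (f g : 'I_n -> 'I_n -> R) :
  (forall p q : 'I_n, (p < q)%N -> f p q = g p q) -> pairprod f = pairprod g.
Proof. by move=> fg; apply: eq_bigr => p _; apply: eq_bigr => q; apply: fg. Qed.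

End PairProductScale.

(** * Specialization at x = 1 *)

Section Germs.
Variable K : numFieldType.

(* [f] agrees with a rational function of value [c] at [0], up to finitely many points. *)
Definition germ (f : K -> K) (c : K) : Prop := exists p q : {poly K},
  [/\ q.[0] != 0, p.[0] = c * q.[0] & forall e, e != 0 -> q.[e] != 0 -> f e = p.[e] / q.[e]].

Lemma germ_poly (p : {poly K}) : germ (fun e => p.[e]) p.[0].
Proof. by exists p, 1; split=> [||e _ _]; rewrite ?hornerE ?oner_neq0 ?invr1 ?mulr1. Qed.

Lemma germ_const c : germ (fun=> c) c.
Proof. by exists c%:P, 1; split=> [||e _ _]; rewrite ?hornerE ?oner_neq0 ?invr1 ?mulr1. Qed.

Lemma germD f g c d : germ f c -> germ g d -> germ (fun e => f e + g e) (c + d).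
Proof.
move=> [p [q [q0 pq fE]]] [p' [q' [q'0 pq' gE]]]; exists (p * q' + p' * q), (q * q').
split=> [||e e0]; rewrite !hornerE /=.
- by rewrite mulf_neq0.
- by rewrite pq pq'; ring.
by rewrite mulf_eq0 negb_or => /andP [h h']; rewrite fE // gE //; field; rewrite h h'.
Qed.

Lemma germM f g c d : germ f c -> germ g d -> germ (fun e => f e * g e) (c * d).
Proof.
move=> [p [q [q0 pq fE]]] [p' [q' [q'0 pq' gE]]]; exists (p * p'), (q * q').
split=> [||e e0]; rewrite !hornerE /=.
- by rewrite mulf_neq0.
- by rewrite pq pq'; ring.
by rewrite mulf_eq0 negb_or => /andP [h h']; rewrite fE // gE //; field; rewrite h h'.
Qed.

Lemma germV f c : c != 0 -> germ f c -> germ (fun e => (f e)^-1) c^-1.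
Proof.
move=> c0 [p [q [q0 pq fE]]]; exists (q * q), (p * q).
split=> [||e e0]; rewrite !hornerE /=.
- by rewrite pq !mulf_neq0.
- by rewrite pq; field.
rewrite mulf_eq0 negb_or => /andP [h h']; rewrite fE //; field; by rewrite h h'.
Qed.

Lemma eq_germ f g c : (forall e, f e = g e) -> germ f c -> germ g c.
Proof. by move=> /functional_extensionality ->. Qed.

Lemma germ_sum (I : Type) (s : seq I) (P : pred I) (f : I -> K -> K) (c : I -> K) :
  (forall i, P i -> germ (f i) (c i)) ->
  germ (fun e => \sum_(i <- s | P i) f i e) (\sum_(i <- s | P i) c i).
Proof.
move=> fc; elim: s => [|i s IHs].
  by rewrite big_nil; apply: eq_germ (germ_const _) => e; rewrite big_nil.
rewrite big_cons; apply: (eq_germ (fun e => esym (big_cons _ _ _ _ _ _))).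
by case: ifP => // Pi; apply: germD => //; apply: fc.
Qed.

Lemma germ_prod (I : Type) (s : seq I) (P : pred I) (f : I -> K -> K) (c : I -> K) :
  (forall i, P i -> germ (f i) (c i)) ->
  germ (fun e => \prod_(i <- s | P i) f i e) (\prod_(i <- s | P i) c i).
Proof.
move=> fc; elim: s => [|i s IHs].
  by rewrite big_nil; apply: eq_germ (germ_const _) => e; rewrite big_nil.
rewrite big_cons; apply: (eq_germ (fun e => esym (big_cons _ _ _ _ _ _))).
by case: ifP => // Pi; apply: germM => //; apply: fc.
Qed.

Lemma germX f c k : germ f c -> germ (fun e => f e ^+ k) (c ^+ k).
Proof.
move=> fc; elim: k => [|k IHk]; first exact: germ_const.
by rewrite exprS; apply: (eq_germ (fun e => esym (exprS (f e) k))); apply: germM.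
Qed.

Lemma germ_pairprod n (f : 'I_n -> 'I_n -> K -> K) (c : 'I_n -> 'I_n -> K) :
  (forall p q, germ (f p q) (c p q)) ->
  germ (fun e => pairprod (fun p q => f p q e)) (pairprod c).
Proof. by move=> fc; apply: germ_prod => p _; apply: germ_prod => q _. Qed.

Lemma germ_unique f g c d (h : {poly K}) : germ f c -> germ g d -> h.[0] != 0 ->
  (forall e, e != 0 -> h.[e] != 0 -> f e = g e) -> c = d.
Proof.
move=> [p [q [q0 pq fE]]] [p' [q' [q'0 pq' gE]]] h0 fg.
(* The extra factor vanishes at every excluded point, so the identity can be tested at all natural
   numbers. *)
have: p * q' * (q * q' * h * 'X) = p' * q * (q * q' * h * 'X).
  apply: (@poly_eq_nat _ _ _ 0) => A _; set e : K := A%:R; rewrite !hornerE /=.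
  have [->|e0] := eqVneq e 0; first by rewrite !mulr0.
  have [->|h1] := eqVneq h.[e] 0; first by rewrite !(mulr0, mul0r).
  have [->|q1] := eqVneq q.[e] 0; first by rewrite !(mulr0, mul0r).
  have [->|q'1] := eqVneq q'.[e] 0; first by rewrite !(mulr0, mul0r).
  have := fg e e0 h1; rewrite fE // gE // => E.
  have -> : p.[e] = p.[e] / q.[e] * q.[e] by rewrite divfK.
  by rewrite E; field; rewrite q'1.
have nz : q * q' * h * 'X != 0.
  rewrite !mulf_neq0 ?polyX_eq0 //.
  - by apply: contraNneq q0 => ->; rewrite horner0.
  - by apply: contraNneq q'0 => ->; rewrite horner0.
  - by apply: contraNneq h0 => ->; rewrite horner0.
move/(mulIf nz)/(congr1 (fun r => r.[0])); rewrite !hornerE pq pq' => E.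
apply: (mulIf q0); apply: (mulIf q'0); rewrite E; ring.
Qed.

(** Modulo t^n the matrix is V diag(t^k) times the coefficient matrix. The tail is t^n times some
    matrix [R' t]; writing [R' t] as V times [invmx V *m R' t] moves it into the last factor with
    weight t^(n-k), which vanishes at t = 0 since k < n. *)
Lemma det_near_zero n (f : 'I_n -> {poly K}) (al : 'I_n -> K) : injective al ->
  exists2 R : {poly K},
    R.[0] = pairprod (fun p q => al q - al p) * \det (\matrix_(k < n, j < n) (f j)`_k) &
    forall t, \det (\matrix_(i < n, j < n) (f j).[t * al i]) = t ^+ (\sum_(k < n) k) * R.[t].
Proof.
move=> al_inj; pose V := \matrix_(i < n, k < n) al i ^+ k.
have detV : \det V = pairprod (fun p q => al q - al p).
  have -> : V = (Vandermonde n (\row_i al i))^T by apply/matrixP => i k; rewrite !mxE.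
  by rewrite det_tr det_Vandermonde; apply: eq_pairprod => p q _; rewrite !mxE.
have V_unit : V \in unitmx.
  rewrite unitmxE unitfE detV; apply/prodf_neq0 => p _; apply/prodf_neq0 => q pq.
  by rewrite subr_eq0 (inj_eq al_inj) -val_eqE /= neq_ltn pq orbT.
pose R' t := \matrix_(i < n, j < n) (al i ^+ n * (drop_poly n (f j)).[t * al i]).
pose W := \matrix_(k < n, j < n) \sum_i (invmx V k i * al i ^+ n) *:
  (drop_poly n (f j) \Po (al i *: 'X)).
have WE t k j : (W k j).[t] = (invmx V *m R' t) k j.
  rewrite !mxE horner_sum; apply: eq_bigr => i _.
  by rewrite !mxE hornerZ horner_comp hornerZ hornerX mulrA [t * _]mulrC.
pose Q := \matrix_(k < n, j < n) (((f j)`_k)%:P + 'X^(n - k) * W k j).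
have QE t k j : (Q k j).[t] = (f j)`_k + t ^+ (n - k) * (invmx V *m R' t) k j.
  by rewrite mxE !hornerE WE.
exists (\det V *: \det Q) => [|t].
  rewrite hornerZ detV; congr (_ * _).
  rewrite -[(\det Q).[0]]/(horner_eval 0 (\det Q)) -det_map_mx; congr (\det _).
  apply/matrixP => k j; rewrite !mxE /= /horner_eval !hornerE expr0n.
  by rewrite subn_eq0 leqNgt ltn_ord mul0r addr0.
have -> : \matrix_(i < n, j < n) (f j).[t * al i] =
    V *m diag_mx (\row_k t ^+ k) *m map_mx (horner_eval t) Q.
  apply/matrixP => i j; rewrite mxE [RHS]mxE.
  transitivity (\sum_(k < n) al i ^+ k * t ^+ k * (f j)`_k +
      t ^+ n * (V *m (invmx V *m R' t)) i j).
    rewrite mulKVmx // mxE -{1}(poly_take_drop n (f j)) !hornerE.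
    rewrite (@horner_coef_wide _ n) ?size_take_poly //; congr (_ + _).
      by apply: eq_bigr => k _; rewrite coef_take_poly ltn_ord exprMn; ring.
    by rewrite exprMn /=; ring.
  rewrite [X in _ * X]mxE mulr_sumr -big_split; apply: eq_bigr => k _ /=.
  rewrite [in RHS]mul_mx_diag [map_mx _ _ _ _]mxE [horner_eval _ _]QE.
  set z := (invmx V *m R' t) k j; rewrite !mxE mulrDr; congr (_ + _).
  by rewrite -{1}(subnKC (ltnW (ltn_ord k))) exprD; ring.
rewrite !det_mulmx det_diag det_map_mx hornerZ /horner_eval mulrCA mulrA; congr (_ * _ * _).
by rewrite -prodrXr; apply: eq_bigr => k _; rewrite mxE.
Qed.

End Germs.

Section Specialization.
Variable K : numFieldType.

Lemma germ_affine (a b : K) : germ (fun e => a + e * b) a.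
Proof.
rewrite -[X in germ _ X]addr0 -[X in germ _ (_ + X)](mul0r b).
apply: germD; first exact: germ_const.
apply: germM; last exact: germ_const.
by have := germ_poly ('X : {poly K}); rewrite hornerX; apply: eq_germ => e; rewrite hornerX.
Qed.

Lemma germ_wt (z : K -> K) d : germ z 1 -> germ (fun e => wt (z e) d) (wt 1 d).
Proof.
move=> zg; case: d => [|[|[|d]]]; rewrite /wt /=; try exact: germ_const; last exact: zg.
by apply: germV zg; rewrite oner_eq0.
Qed.

Lemma germ_agtp N m (x : K -> nat -> K) r (k : {ffun 'I_N -> 'I_m.+1}) :
  (forall i, germ (fun e => x e i) 1) ->
  germ (fun e => agtp (x e) r k) (agtp (fun=> 1) r k).
Proof.
move=> xg; elim: r k => [|r IHr] k; first exact: germ_const.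
apply: germ_sum => l _; apply: germ_sum => d _; apply: germM => //.
rewrite /rowwt; apply: germM.
  apply: germM; first exact: germ_const.
  by apply: germ_prod => j _; apply: germM; [apply: germ_wt | apply: germX].
apply: germ_prod => j _; apply: germM; first exact: germ_const.
by apply: germV; [rewrite expr1n oner_eq0 | apply: germX].
Qed.

Variables (n m : nat).
Hypothesis n0 : (0 < n)%N.

(** Positive integers are nonzero with distinct squares, so neither the product of the nodes nor the
    Vandermonde product of their squares vanishes. *)
Definition node (i : nat) : K := i.+1%:R.

(* x = (1 + w) / (1 - w) turns x -> 1 / x into w -> - w. *)
Definition point (e : K) (i : nat) : K := (1 + e * node i) / (1 + e * - node i).

Lemma germ_point i : germ (fun e => point e i) 1.
Proof.
rewrite -[X in germ _ X]mulr1 -[X in germ _ (_ * X)]invr1.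
by apply: germM; [|apply: germV; first exact: oner_neq0]; apply: germ_affine.
Qed.

Let A := (m + n.*2.-1)%N.
Let C := (\sum_(q < n) q)%N.
(** At x = (1 + w)/(1 - w) this is (1 + w)^A [ww x]^j, and its value at -w is (1 - w)^A [zz x]^j.
    Hence (1 - w)^A times an entry of the determinant is P(-w) - P(w), an odd polynomial. *)
Let P (j : nat) : {poly K} := 2 ^+ j *: (1 - 'X) ^+ j * (1 + 'X) ^+ (A - j.*2).

Lemma dblA (j : 'I_n) : (j.*2 <= A)%N.
Proof. by have := ltn_ord j; rewrite /A; lia. Qed.

Lemma lwdet_entry (w : K) (j : 'I_n) : 1 + w != 0 -> 1 - w != 0 ->
  let x := (1 + w) / (1 - w) in
  zz x ^+ j - x ^+ A * ww x ^+ j =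
  (1 - w) ^- A * (-2 * w) * (odd_poly (P j)).[w ^+ 2].
Proof.
move=> w1 w2 x.
have x0 : x != 0 by rewrite mulf_neq0 ?invr_eq0.
have PN : (1 - w) ^+ A * zz x ^+ j = (P j).[- w].
  rewrite /P !hornerE opprK -{1}(subnK (dblA j)) exprD -mul2n exprM.
  have -> : zz x = 2 * (1 + w) / (1 - w) ^+ 2 by rewrite /zz /x; field.
  by rewrite expr_div_n !exprMn /=; field; rewrite ?expf_neq0.
have PP : (1 - w) ^+ A * x ^+ A * ww x ^+ j = (P j).[w].
  have -> : (1 - w) ^+ A * x ^+ A = (1 + w) ^+ A by rewrite -exprMn /x mulrC divfK.
  rewrite /P !hornerE.
  rewrite -{1}(subnK (dblA j)) exprD -mul2n exprM.
  have -> : ww x = 2 * (1 - w) / (1 + w) ^+ 2 by rewrite /ww /zz /x; field; rewrite w1 w2.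
  by rewrite expr_div_n !exprMn /=; field; rewrite ?expf_neq0.
have A0 : (1 - w) ^+ A != 0 by rewrite expf_neq0.
apply: (mulfI A0); rewrite -mulrA mulVKf // mulrBr mulrA PN PP.
rewrite -{1 2}(poly_even_odd (P j)) !hornerE !horner_comp !hornerE.
by rewrite sqrrN /=; ring.
Qed.

Let al (i : nat) : K := node i ^+ 2.

Lemma al_inj : injective (fun i : 'I_n => al i).
Proof.
move=> i j /eqP; rewrite /al /node -!natrX eqr_nat eqn_exp2r // eqSS => /eqP ij.
exact: val_inj.
Qed.

Lemma lwdet_point (e : K) :
  (forall i, (i < n)%N -> 1 + e * node i != 0) ->
  (forall i, (i < n)%N -> 1 + e * - node i != 0) ->
  lwdet (fun i : 'I_n => point e i ^+ (m.+1 + n.*2) / point e i ^+ 2)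
    (fun i : 'I_n => point e i) =
  e ^+ n * (\prod_(i < n) (-2 * node i * (1 + e * - node i)^-1 ^+ A)) *
    \det (\matrix_(i < n, j < n) (odd_poly (P j)).[e ^+ 2 * al i]).
Proof.
move=> w1 w2; have AE : (m.+1 + n.*2 = A + 2)%N by move: n0; rewrite /A; lia.
have -> : e ^+ n * (\prod_(i < n) (-2 * node i * (1 + e * - node i)^-1 ^+ A)) =
    \prod_(i < n) ((1 - e * node i) ^- A * (-2 * (e * node i))).
  have -> : e ^+ n = \prod_(i < n) e by rewrite prodr_const card_ord.
  rewrite -big_split; apply: eq_bigr => i _ /=; rewrite mulrN exprVn.
  by move: (_ ^- _) => y; ring.
have -> : \prod_(i < n) ((1 - e * node i) ^- A * (-2 * (e * node i))) =
    \det (diag_mx (\row_(i < n) ((1 - e * node i) ^- A * (-2 * (e * node i))))).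
  by rewrite det_diag; apply: eq_bigr => i _; rewrite mxE.
rewrite -det_mulmx /lwdet; congr (\det _); rewrite mul_diag_mx; apply/matrixP => i j; rewrite !mxE.
have h1 := w1 i (ltn_ord i); have h2 := w2 i (ltn_ord i); rewrite mulrN in h2.
have pE : point e i = (1 + e * node i) / (1 - e * node i) by rewrite /point mulrN.
rewrite /al -exprMn -lwdet_entry //= -pE AE exprD mulfK // expf_neq0 // pE.
by rewrite mulf_neq0 ?invr_eq0.
Qed.

Lemma det_odd_poly :
  \det (\matrix_(k < n, j < n) (odd_poly (P j))`_k) = (\det (paramdet K n)).[A%:R].
Proof.
rewrite -[RHS]/(horner_eval A%:R _) -det_map_mx; congr (\det _).
apply/matrixP => k j; rewrite !mxE coef_odd_poly -[RHS]/((oddcoef _ _ _).[_]).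
by rewrite horner_oddcoef ?dblA.
Qed.

(** The powers of e on the two sides of [total_generating_function] agree and cancel. The limits 2
    (node_j - node_i) and -2 (node_i + node_j) multiply to -4 (al_j - al_i), whose product over
    pairs leaves (-4)^C after cancelling the Vandermonde product from [det_near_zero]. *)
Theorem limit_identity :
  (\sum_(k : {ffun 'I_n -> 'I_m.+1} | strict_row k) agtp (fun=> 1 : K) n k) * (-4) ^+ C =
  3 ^+ n * (\det (paramdet K n)).[A%:R].
Proof.
set S := \sum_(k | _) _.
have [R R0 Rt] := det_near_zero (fun j : 'I_n => odd_poly (P j)) al_inj.
rewrite det_odd_poly in R0.
pose F e := \sum_(k : {ffun 'I_n -> 'I_m.+1} | strict_row k) agtp (point e) n k.
have gF : germ F S by apply: germ_sum => k _; apply: germ_agtp => i; apply: germ_point.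
pose q i e := (1 + e * - node i)^-1.
have gq i : germ (q i) 1.
  rewrite -[X in germ _ X]invr1; apply: germV; [exact: oner_neq0 | exact: germ_affine].
pose v e := pairprod (fun i j : 'I_n => 2 * (node j - node i) * (q i e * q j e)).
pose u1 e := \prod_(i < n) (-2 * node i * q i e).
pose u2 e := pairprod (fun i j : 'I_n => -2 * (node i + node j) * (q i e * q j e)).
pose pr e := \prod_(i < n) (1 + point e i + (point e i)^-1).
pose l e := \prod_(i < n) (-2 * node i * q i e ^+ A) * R.[e ^+ 2].
(* The zeros of [h] are the values of e where some point is undefined, zero or a root of 1 + x +
   x^2; the last factor is the numerator of that quadratic. *)
pose h : {poly K} := \prod_(i < n)
  ((1 + 'X * (node i)%:P) * (1 + 'X * (- node i)%:P) * (3%:P + ('X * (node i)%:P) ^+ 2)).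
have gv : germ v (pairprod (fun i j : 'I_n => 2 * (node j - node i) * (1 * 1))).
  by apply: germ_pairprod => i j; apply: germM; [exact: germ_const | apply: germM; apply: gq].
have gu1 : germ u1 (\prod_(i < n) (-2 * node i * 1)).
  by apply: germ_prod => i _; apply: germM; [exact: germ_const | apply: gq].
have gu2 : germ u2 (pairprod (fun i j : 'I_n => -2 * (node i + node j) * (1 * 1))).
  by apply: germ_pairprod => i j; apply: germM; [exact: germ_const | apply: germM; apply: gq].
have gpr : germ pr (\prod_(i < n) (1 + 1 + 1^-1)).
  apply: germ_prod => i _; apply: germD; first by apply: germD; [exact: germ_const | exact: germ_point].
  by apply: germV; [exact: oner_neq0 | exact: germ_point].
have gl : germ l (\prod_(i < n) (-2 * node i * 1 ^+ A) * R.[0]).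
  apply: germM; first by apply: germ_prod => i _; apply: germM; [exact: germ_const | apply: germX].
  have := germ_poly (R \Po 'X^2); rewrite horner_comp hornerXn expr0n.
  by apply: eq_germ => e; rewrite horner_comp hornerXn.
have h0 : h.[0] != 0.
  rewrite /h horner_prod; apply/prodf_neq0 => i _; rewrite !hornerE /=.
  by rewrite expr0n addr0 pnatr_eq0.
have key e : e != 0 -> h.[e] != 0 -> F e * (v e * (u1 e * u2 e)) = pr e * l e.
  move=> e0; rewrite /h horner_prod => /prodf_neq0 hn.
  have hi (i : nat) : (i < n)%N ->
      [&& 1 + e * node i != 0, 1 + e * - node i != 0 & 3 + (e * node i) ^+ 2 != 0].
    move=> ile; have := hn (Ordinal ile) isT.
    by rewrite !hornerE /= !mulf_eq0 !negb_or -andbA expr2 mulrA.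
  have h1 i (ile : (i < n)%N) : 1 + e * node i != 0 by case/and3P: (hi i ile).
  have h2 i (ile : (i < n)%N) : 1 + e * - node i != 0 by case/and3P: (hi i ile).
  have reg i : (i < n)%N -> regular (point e i).
    move=> ile; case/and3P: (hi i ile) => w1 w2 w3; apply/and3P; split.
    - by rewrite mulf_neq0 ?invr_eq0.
    - have -> : 1 + point e i = 2 / (1 + e * - node i).
        by rewrite /point; move: (node i) w2 => y w2; field.
      by rewrite mulf_neq0 ?invr_eq0 ?pnatr_eq0.
    have -> : 1 + point e i + point e i ^+ 2 = (3 + (e * node i) ^+ 2) / (1 + e * - node i) ^+ 2.
      by rewrite /point; move: (node i) w2 => y w2; field.
    by rewrite mulf_neq0 ?invr_eq0 ?expf_neq0.
  have diff i j : (i < n)%N -> (j < n)%N ->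
      point e j - point e i = e * (2 * (node j - node i) * (q i e * q j e)).
    move=> ile jle; have := h2 i ile; have := h2 j jle; rewrite /point /q.
    by move: (node i) (node j) => y z hz hy; field; rewrite hy hz.
  have dist i j : (i < j)%N -> (j < n)%N -> point e i != point e j.
    move=> ij jle; have ile := ltn_trans ij jle; rewrite eq_sym -subr_eq0 diff //.
    rewrite !mulf_neq0 ?invr_eq0 ?h2 ?pnatr_eq0 // subr_eq0 eqr_nat eqSS.
    by rewrite neq_ltn ij orbT.
  have := total_generating_function m reg dist; rewrite -/(F e) lwdet_point // Rt.
  have -> : vdm (point e) n = e ^+ C * v e.
    rewrite -pairprod_const -pairprodM; apply: eq_pairprod => i j _.
    by rewrite diff.
  have -> : \prod_(i < n) (1 - point e i) = e ^+ n * u1 e.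
    have -> : e ^+ n = \prod_(i < n) e by rewrite prodr_const card_ord.
    rewrite -big_split; apply: eq_bigr => i _ /=; have := h2 i (ltn_ord i).
    by rewrite /point /q; move: (node i) => y hy; field.
  have -> : pairprod (fun i j : 'I_n => 1 - point e i * point e j) = e ^+ C * u2 e.
    rewrite -pairprod_const -pairprodM; apply: eq_pairprod => i j _.
    have := h2 i (ltn_ord i); have := h2 j (ltn_ord j).
    by rewrite /point /q; move: (node i) (node j) => y z hz hy; field; rewrite hy hz.
  rewrite -/(pr e) -exprM -/C => E.
  have nz : e ^+ C * e ^+ n * e ^+ C != 0 by rewrite !mulf_neq0 ?expf_neq0.
  apply: (mulIf nz).
  have EE : e ^+ (2 * C) = e ^+ C * e ^+ C by rewrite -exprD mul2n -addnn.
  rewrite EE in E.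
  have perm1 (f x y vv uu1 uu2 : K) : f * (vv * (uu1 * uu2)) * (x * y * x) =
    f * (x * vv) * (y * uu1 * (x * uu2)) by ring.
  rewrite perm1 E /l /q.
  have perm2 (p x y z r : K) : p * (y * z * (x * x * r)) = p * (z * r) * (x * y * x) by ring.
  exact: perm2.
have := germ_unique (germM gF (germM gv (germM gu1 gu2))) (germM gpr gl) h0 key.
set U := \prod_(i < n) (-2 * node i * 1).
have -> : \prod_(i < n) (-2 * node i * 1 ^+ A) = U by apply: eq_bigr => i _; rewrite expr1n.
have -> : \prod_(i < n) (1 + 1 + 1^-1) = 3 ^+ n :> K.
  by rewrite prodr_const card_ord invr1; congr (_ ^+ _); ring.
rewrite R0; set D := pairprod (fun i j : 'I_n => al j - al i).
have DD : pairprod (fun i j : 'I_n => 2 * (node j - node i) * (1 * 1)) *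
   pairprod (fun i j : 'I_n => -2 * (node i + node j) * (1 * 1)) = (-4) ^+ C * D.
  rewrite -pairprod_const -!pairprodM; apply: eq_pairprod => i j _; rewrite /al; ring.
have D0 : D != 0.
  apply/prodf_neq0 => i _; apply/prodf_neq0 => j ij.
  by rewrite subr_eq0 (inj_eq al_inj) -val_eqE /= neq_ltn ij orbT.
have U0 : U != 0.
  apply/prodf_neq0 => i _; rewrite mulr1 mulf_neq0 ?oppr_eq0 ?pnatr_eq0 //.
move=> E; apply: (mulIf (mulf_neq0 U0 D0)).
have perm3 (s a b c : K) : s * (a * (b * c)) = s * (a * c) * b by ring.
rewrite perm3 DD in E.
have perm4 (s a b c : K) : s * a * (b * c) = s * (a * c) * b by ring.
rewrite perm4 E.
have perm5 (a b c d : K) : a * (b * (c * d)) = a * d * (b * c) by ring.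
exact: perm5.
Qed.

End Specialization.

(** * Pochhammer symbols and the final evaluation *)

Lemma poch_fact a : poch a.+1%:R a.+1 * a`!%:R = (a.*2.+1)`!%:R.
Proof.
rewrite /poch; suff: forall l, \prod_(i < l) (a.+1%:R + i%:R) * a`!%:R = (a + l)`!%:R :> rat.
  by move=> ->; rewrite addnS addnn.
elim=> [|l IHl]; first by rewrite big_ord0 mul1r addn0.
by rewrite big_ord_recr /= mulrAC IHl -natrD -natrM addnS factS addSn mulnC.
Qed.

(** With A = m + 2n - 1 and i = a + 1, factor l of the Pochhammer symbol is A - 3a + l, hence the
    zero factor for b = a - l. *)
Lemma poch_shift (n m a : nat) : (0 < n)%N ->
  poch ((2 * n + m + 2)%:R - 3 * a.+1%:R) a.+1 =
  \prod_(b < a.+1) ((m + n.*2.-1)%:R - (b + a.*2)%:R).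
Proof.
move=> n0; rewrite /poch (reindex_inj rev_ord_inj) /=; apply: eq_bigr => b _.
have ba : (b <= a)%N by rewrite -ltnS.
have -> : (2 * n + m + 2 = m + n.*2.-1 + 3)%N by lia.
by rewrite subSS natrB // !natrD -[a.*2]addnn !natrD -[a.+1%:R]natr1; ring.
Qed.

Unset Implicit Arguments.

Theorem theorem1p2 (n m : nat) (hn : (1 <= n)%N) :
  ((\sum_(P : Pat n m | [&& arrowed_GT P, no_double P & bottom_strict P]) sgn P)%:~R : rat)
  = 3%:R ^+ 'C(n.+1, 2) *
    \prod_(1 <= i < n.+1)
      (poch ((2 * n + m + 2)%:R - 3 * i%:R) i / poch i%:R i).
Proof.
rewrite (@sum_patterns rat) //.
have nz : (-4) ^+ (\sum_(q < n) q)%N != 0 :> rat by rewrite expf_neq0.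
apply: (mulIf nz); rewrite limit_identity // paramdet_factor det_leadmx hornerZ zeropolyE.
rewrite horner_prod -bin2_sum big_nat_recl // add0n [in RHS]big_add1 /=.
rewrite !big_mkord -!prodrXr -!big_split /=.
have -> : 3 ^+ n = \prod_(a < n) 3 :> rat by rewrite prodr_const card_ord.
rewrite -!big_split /=; apply: eq_bigr => a _.
rewrite poch_shift // horner_prod; under eq_bigr do rewrite hornerXsubC.
set X := \prod_(b < _) _; have pf := poch_fact a.
have f0 := natr_fact_neq0 rat a; have f1 := natr_fact_neq0 rat a.*2.+1.
have p0 : poch a.+1%:R a.+1 != 0 by apply: contraNneq f1 => p0; rewrite -pf p0 mul0r.
(* The powers of -4 cancel those left by the limit, and 3^a joins the factor 3 of 1 + x + 1/x to
   give 3^(a+1), the share of i = a + 1 in the power of 3. *)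
rewrite -pf exprS; have -> : (-6) ^+ a * 2 ^+ a = 3 ^+ a * (-4) ^+ a :> rat.
  by rewrite -!exprMn; congr (_ ^+ _).
by field; rewrite f0 p0.
Qed.
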